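(* Let $T$ be a spherically homogeneous locally finite rooted tree and let $G\le \mathrm{Aut}(T)$ be a finitely generated branch group whose action on $\partial T$ has finite groups of germs. Then every cardinal-definite function on $G$ is at bounded distance from a function of the form $$\sum_{i=1}^r\alpha_i\,\nu_{A_i}+\sum_{i=1}^s|\phi_i|,$$ where each $A_i$ is a commensurated subset of (the vertex set of) the graph of germs $\widetilde\Gamma_{\xi_i}$ for some $\xi_i\in\partial T$, each $\alpha_i\in\mathbb Q_{>0}$, and $\phi_1,\dots,\phi_s\colon G\dashrightarrow\mathbb Z$ are finitely many virtual homomorphisms.
   Context: Branch groups. For a vertex $v$ of $T$, $T_v$ is the subtree of descendants of $v$; $\mathrm{RiSt}(v)$ is the subgroup of elements of $G$ fixing every vertex of $T\setminus T_v$; $\mathrm{RiSt}(n)=\langle \mathrm{RiSt}(v):|v|=n\rangle$. $G\le\mathrm{Aut}(T)$ (root-preserving automorphisms) is branch if it acts transitively on every level of $T$ and $\mathrm{RiSt}(n)$ has finite index in $G$ for every $n$. Germs. For $\xi\in\partial T$, $G_\xi$ is the stabilizer and $G_\xi^0\trianglelefteq G_\xi$ is the subgroup of elements fixing pointwise a neighbourhood of $\xi$ in $\partial T$; finite groups of germs means $G_\xi/G_\xi^0$ is finite for every $\xi$. The graph of germs $\widetilde\Gamma_\xi$ is the Schreier graph of $G/G_\xi^0$; its vertex set is the $G$-set $G/G_\xi^0$. Cardinal-definite functions. For a $G$-set $X$, a subset $A\subset X$ is commensurated if $gA\triangle A$ is finite for every $g\in G$; then $\nu_A(g)=|gA\triangle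 A|$ is the associated cardinal-definite function. A cardinal-definite function on $G$ is any function of the form $\nu_A$, for some $G$-set. Two functions on $G$ are at bounded distance if their difference is bounded. Virtual homomorphisms. A virtual homomorphism $\phi\colon G\dashrightarrow\mathbb Z$ is a homomorphism to $\mathbb Z$ defined on a finite-index subgroup $\mathrm{Dom}(\phi)\le G$. It is regarded as a function on $G$ (well defined up to bounded distance) by choosing a set $\Omega$ of coset representatives of $\mathrm{Dom}(\phi)$ and setting $\widehat\phi(ht)=\phi(h)$ for $h\in\mathrm{Dom}(\phi)$, $t\in\Omega$; in the formula, $|\phi_i|$ means $|\widehat{\phi_i}|$. *)

(* Defs.v *)
From HB Require Import structures.
From mathcomp Require Import all_boot all_order all_algebra monoid.
From mathcomp Require Import boolp classical_sets functions cardinality.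

Set Implicit Arguments.
Unset Strict Implicit.
Unset Printing Implicit Defensive.

Import Order.TTheory GRing.Theory Num.Theory.

Local Open Scope classical_set_scope.
Local Open Scope card_scope.
Local Open Scope group_scope.

(* Junk value 0 if A is infinite. *)
Definition ncard (X : Type) (A : set X) : nat := xget 0%N [set n | A #= `I_n].

Section Groups.
Variable gT : groupType.
Implicit Types (G H S Omega : set gT) (g : gT).

Definition is_subgroup H : Prop := group_closed (mem H).

Definition generated S : set gT := smallest is_subgroup S.

Definition finitely_generated G : Prop :=
  exists2 S : set gT, finite_set S & generated S = G.

Definition translate g (C : set gT) : set gT := [set g * c | c in C].

Definition lcosets G H : set (set gT) := [set translate g H | g in G].

Definition finite_index H G : Prop := finite_set (lcosets G H).

(* Only the elements of the subgroup G are required to act. *)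
Definition is_action G (X : Type) (act : gT -> X -> X) : Prop :=
  (forall x, act 1 x = x) /\
  (forall g h x, G g -> G h -> act (g * h) x = act g (act h x)).

Definition displacement (X : Type) (act : gT -> X -> X) (A : set X) g : set X :=
  (act g @` A) `+` A.

Definition commensurated G (X : Type) (act : gT -> X -> X) (A : set X) : Prop :=
  forall g, G g -> finite_set (displacement act A g).

Definition nu (X : Type) (act : gT -> X -> X) (A : set X) g : nat :=
  ncard (displacement act A g).

(* Functions on the subgroup G are represented by functions on gT whose values
   outside G are irrelevant. *)
Definition cardinal_definite G (f : gT -> nat) : Prop :=
  exists (X : Type) (act : gT -> X -> X) (A : set X),
    [/\ is_action G act, commensurated G act A
      & forall g, G g -> f g = nu act A g].

Definition bounded_distance G (f1 f2 : gT -> rat) : Prop :=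
  exists C : rat, forall g, G g -> (`|f1 g - f2 g| <= C)%R.

Record virtual_hom G := VirtualHom {
  vh_dom : set gT;
  vh_fun : gT -> int;
  vh_dom_subgroup : is_subgroup vh_dom;
  vh_dom_sub : vh_dom `<=` G;
  vh_dom_index : finite_index vh_dom G;
  vh_funM : {in vh_dom &, {morph vh_fun : x y / x * y >-> (x + y)%R}} }.

(* Representatives of the right cosets H t, as in g = h t. *)
Definition coset_representatives G H Omega : Prop :=
  Omega `<=` G /\ forall g, G g -> exists! t, Omega t /\ H (g / t).

Definition coset_rep H Omega g : gT := xget 1 [set t | Omega t /\ H (g / t)].

Definition vh_extend G (phi : virtual_hom G) Omega g : int :=
  vh_fun phi (g / coset_rep (vh_dom phi) Omega g).

Lemma vh_extendE G (phi : virtual_hom G) Omega h t :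
  is_subgroup G -> coset_representatives G (vh_dom phi) Omega ->
  vh_dom phi h -> Omega t -> vh_extend phi Omega (h * t) = vh_fun phi h.
Proof.
move=> sG [sub_Omega uniq_rep] dh Ot.
have Gh : G h by exact: vh_dom_sub dh.
have Ght : G (h * t).
  have /(_ h t) := group_closedM sG.
  by rewrite -!topredE /= !inE; apply => //; exact: sub_Omega.
have [u [_ uu]] := uniq_rep _ Ght.
have dt : vh_dom phi (h * t / t) by rewrite mulgK.
rewrite /vh_extend /coset_rep (@xget_unique _ _ _ t) ?mulgK //.
by move=> y ydom; rewrite -(uu y ydom) -(uu t).
Qed.

End Groups.

(* A rooted tree, given by its parent map; the edges join each v != root to
   parent v. The axioms force parent root = root and make level v the distance
   from v to the root. *)
Record rooted_tree := RootedTree {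
  vertex :> Type;
  root : vertex;
  parent : vertex -> vertex;
  level : vertex -> nat;
  level_eq0 : forall v, level v = 0%N <-> v = root;
  level_parent : forall v, level (parent v) = (level v).-1 }.

Section Trees.
Variable T : rooted_tree.
Implicit Types (v w : T).

Definition children v : set T := [set w | w <> root T /\ parent w = v].

Definition locally_finite : Prop := forall v, finite_set (children v).

Definition spherically_homogeneous : Prop :=
  forall v w, level v = level w -> children v #= children w.

Definition subtree v : set T := [set w | exists k, iter k (@parent T) w = v].

(* Commuting with parent forces the root to be fixed; see aut_root. *)
Record tree_aut := TreeAut {
  aut_fun :> T -> T;
  aut_inv : T -> T;
  aut_funK : cancel aut_fun aut_inv;
  aut_invK : cancel aut_inv aut_fun;
  aut_parent : forall v, aut_fun (parent v) = parent (aut_fun v) }.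

Lemma tree_autP (g h : tree_aut) : g =1 h -> g = h.
Proof.
case: g h => [f f' fK f'K fp] [k k' kK k'K kp] /= /funext eq_fk.
case: _ / eq_fk kK k'K kp => kK k'K kp.
have eq_fk' : f' = k' by apply/funext => x; rewrite -[LHS]kK f'K.
by case: _ / eq_fk' kK k'K => kK k'K; congr TreeAut; exact: Prop_irrelevance.
Qed.

Lemma aut_inv_parent (g : tree_aut) v :
  aut_inv g (parent v) = parent (aut_inv g v).
Proof. by rewrite -{1}(aut_invK g v) -aut_parent aut_funK. Qed.

Definition aut_one : tree_aut :=
  @TreeAut id id (fun=> erefl) (fun=> erefl) (fun=> erefl).

Definition aut_V (g : tree_aut) : tree_aut :=
  TreeAut (aut_invK g) (aut_funK g) (aut_inv_parent g).

Lemma aut_comp_parent (g h : tree_aut) v :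
  (g \o h) (parent v) = parent ((g \o h) v).
Proof. by rewrite /= !aut_parent. Qed.

Definition aut_mul (g h : tree_aut) : tree_aut :=
  TreeAut (can_comp (aut_funK g) (aut_funK h))
    (can_comp (aut_invK h) (aut_invK g)) (aut_comp_parent g h).

HB.instance Definition _ := gen_eqMixin tree_aut.
HB.instance Definition _ := gen_choiceMixin tree_aut.

Lemma aut_mulA : associative aut_mul.
Proof. by move=> g h k; exact: tree_autP. Qed.

Lemma aut_mul1g : left_id aut_one aut_mul.
Proof. by move=> g; exact: tree_autP. Qed.

Lemma aut_mulg1 : right_id aut_one aut_mul.
Proof. by move=> g; exact: tree_autP. Qed.

Lemma aut_mulVg : left_inverse aut_one aut_V aut_mul.
Proof. by move=> g; apply: tree_autP => x; exact: aut_funK. Qed.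

Lemma aut_mulgV : right_inverse aut_one aut_V aut_mul.
Proof. by move=> g; apply: tree_autP => x; exact: aut_invK. Qed.

HB.instance Definition _ :=
  isGroup.Build tree_aut aut_mulA aut_mul1g aut_mulg1 aut_mulVg aut_mulgV.

Lemma parent_root : parent (root T) = root T.
Proof. by apply/level_eq0; rewrite level_parent (level_eq0 _).2. Qed.

Lemma aut_root (g : tree_aut) : g (root T) = root T.
Proof.
have fixed_root v : parent v = v -> v = root T.
  move=> pv; apply/level_eq0; have := level_parent v.
  by rewrite pv; case: (level v) => //= n eq_n; case: (n_Sn n (esym eq_n)).
by apply: fixed_root; rewrite -aut_parent parent_root.
Qed.

Lemma aut_level (g : tree_aut) v : level (g v) = level v.
Proof.
have [n] := ubnP (level v); elim: n v => // n IHn v lt_vn.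
have [/level_eq0 v0|v_pos] := eqVneq (level v) 0%N; first by rewrite v0 aut_root.
have gv_pos : level (g v) != 0%N.
  apply: contra_neq v_pos => /level_eq0 gv0.
  apply/level_eq0; apply: (can_inj (aut_funK g)).
  by rewrite gv0 aut_root.
have := IHn (parent v); rewrite aut_parent !level_parent.
move: v_pos gv_pos lt_vn.
by case: (level v) (level (g v)) => [|k] [|l] //= _ _ lt_kn ->.
Qed.

Record ray := Ray {
  ray_at :> nat -> T;
  ray_level : forall n, level (ray_at n) = n;
  ray_parent : forall n, parent (ray_at n.+1) = ray_at n }.

Lemma aut_ray_level (g : tree_aut) (xi : ray) n : level (g (xi n)) = n.
Proof. by rewrite aut_level ray_level. Qed.

Lemma aut_ray_parent (g : tree_aut) (xi : ray) n :
  parent (g (xi n.+1)) = g (xi n).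
Proof. by rewrite -aut_parent ray_parent. Qed.

Definition ray_act (g : tree_aut) (xi : ray) : ray :=
  @Ray (fun n => g (xi n)) (aut_ray_level g xi) (aut_ray_parent g xi).

(* The sets of rays sharing a given initial segment form a basis of the
   topology of the boundary. *)
Definition cylinder (xi : ray) n : set ray := [set eta | eta n = xi n].

Definition boundary_nbhs (xi : ray) (U : set ray) : Prop :=
  exists n, cylinder xi n `<=` U.

Variable G : set tree_aut.

Definition level_transitive : Prop :=
  forall v w, level v = level w -> exists2 g, G g & g v = w.

Definition rist v : set tree_aut :=
  [set g | G g /\ forall w, ~ subtree v w -> g w = w].

Definition rist_level n : set tree_aut :=
  generated (\bigcup_(v in [set v | level v = n]) rist v).

Definition branch_group : Prop :=
  level_transitive /\ forall n, finite_index (rist_level n) G.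

Definition stab (xi : ray) : set tree_aut :=
  [set g | G g /\ ray_act g xi = xi].

Definition germ_stab (xi : ray) : set tree_aut :=
  [set g | G g /\ exists2 U, boundary_nbhs xi U
                           & forall eta, U eta -> ray_act g eta = eta].

Definition finite_germs : Prop :=
  forall xi, finite_index (germ_stab xi) (stab xi).

(* The vertex set of the graph of germs; G acts on it by translate. *)
Definition germ_vertices (xi : ray) : set (set tree_aut) :=
  lcosets G (germ_stab xi).

End Trees.

(* Main.v *)
(** Let [G] act transitively on an infinite set [Y] and let [A] be a
    commensurated subset. For a vertex [v], the rigid stabilizer [K] of [v] and
    the pointwise stabilizer [R] of the subtree at [v] commute, and [K * R] has
    finite index, so [K] and [R] are finitely generated.

    If at some level no [R] has a finite orbit on [Y], then every piece of [A]
    that matters lies in an orbit of some [K] on which a finite-index subgroup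
    of [R] acts with infinite orbits by automorphisms. Such an automorphism [z]
    can be chosen to shift [A] strictly into itself, whence the orbit is a
    disjoint union of translates [z^k W] with [W] finite, and [nu_A] is a sum of
    absolute values of shifts, which are homomorphisms on a finite-index
    subgroup.

    Otherwise at each level exactly one [R] has a finite orbit at a given point,
    and these vertices form a ray [xi]. The stabilizer of the point fixes [xi],
    and the germ stabilizer [J] of [xi] partitions [Y] into classes. Each class
    is an increasing union of finite sets [R y] and, [A] having a finite
    boundary, all but finitely many classes are contained in [A] or disjoint
    from it. If the classes are infinite then [A] is finite or cofinite; if
    they are finite then, [J] having finite index in the stabilizer of [xi], [A]
    and a commensurated subset of [G / J] correspond to each other under a
    relation with constant finite fibres, which gives the coefficient. *)

(* The obstacle is to control [A] on an infinite Schreier graph knowing only that its boundary is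
   finite. Commuting subgroups overcome it: a set moved by an element that commutes with the
   generators has its boundary moved along, so finite boundaries can be made disjoint.

   An arbitrary action reduces to finitely many transitive ones, because with respect to a finite
   generating set only the orbits meeting the boundary of [A] contribute to [nu_A].

   In the first case the comparison is made on a subgroup of finite index only. As [nu_A] is
   subadditive, it extends to the whole group with an error governed by finitely many coset
   representatives, so each stage may pass to a smaller subgroup.

   In the last case a point of [Y] is related to [k] cosets of [J] and a coset to [m] points.
   Counting related pairs over the displacements gives the coefficient [m / k]; finite groups of
   germs make [k] finite, and finite classes make [m] finite. *)
Require Import Defs.
From HB Require Import structures.
From mathcomp Require Import all_boot all_order all_algebra monoid.
From mathcomp Require Import finmap boolp classical_sets functions cardinality.
From mathcomp Require Import zify lra.

Set Implicit Arguments.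
Unset Strict Implicit.
Unset Printing Implicit Defensive.

Import Order.TTheory GRing.Theory Num.Theory.

(** * Cardinals of finite sets *)

Section Cardinals.
Local Open Scope classical_set_scope.
Local Open Scope card_scope.

Lemma ncardP (X : Type) (A : set X) : finite_set A -> A #= `I_(ncard A).
Proof. by move=> [n An]; rewrite /ncard; case: xgetP => [y _ //|/(_ n)]. Qed.

Lemma ncard_eq (X : Type) (A : set X) n : A #= `I_n -> ncard A = n.
Proof.
move=> An; have /ncardP eqA : finite_set A by exists n.
by apply: esym; apply/card_eq_II; apply: card_eq_trans eqA; rewrite card_eq_sym.
Qed.

Lemma ncard_set0 (X : Type) : ncard (@set0 X) = 0%N.
Proof. by apply: ncard_eq; rewrite II0. Qed.

Lemma ncard_fset (X : choiceType) (A : set X) :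
  finite_set A -> ncard A = #|` fset_set A|.
Proof. by move=> /ncardP /card_fset_set. Qed.

Lemma leq_ncard_card_le (X Y : Type) (A : set X) (B : set Y) :
  finite_set B -> A #<= B -> (ncard A <= ncard B)%N.
Proof.
move=> finB leAB; have /ncardP eqA := card_le_finite leAB finB.
rewrite -card_le_II -(card_le_eql eqA).
by apply: card_le_trans leAB _; have := ncardP finB;
  rewrite card_eq_le => /andP[].
Qed.

Lemma leq_ncard (X : Type) (A B : set X) :
  finite_set B -> A `<=` B -> (ncard A <= ncard B)%N.
Proof. by move=> finB /subset_card_le; apply: leq_ncard_card_le. Qed.

Lemma leq_ncard_image (X Y : Type) (f : X -> Y) (A : set X) :
  finite_set A -> (ncard (f @` A) <= ncard A)%N.
Proof.
by move=> finA; apply: leq_ncard_card_le => //; apply: card_image_le.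
Qed.

Lemma ncard_image_inj (X Y : Type) (f : X -> Y) (A : set X) :
  finite_set A -> {in A &, injective f} -> ncard (f @` A) = ncard A.
Proof.
move=> finA injf; apply: ncard_eq.
by apply: card_eq_trans (inj_card_eq injf) _; apply: ncardP.
Qed.

Lemma finite_setUI (X : Type) (A B : set X) :
  finite_set A -> finite_set B -> finite_set (A `|` B).
Proof. by rewrite finite_setU. Qed.

Lemma ncardU (X : Type) (A B : set X) :
  finite_set A -> finite_set B -> A `&` B = set0 ->
  ncard (A `|` B) = (ncard A + ncard B)%N.
Proof.
move=> finA finB AB0; rewrite (@ncard_fset {classic X});
  last by rewrite finite_setU.
rewrite !(@ncard_fset {classic X}) // fset_setU // cardfsU -fset_setI //.
by rewrite AB0 fset_set0 cardfs0 subn0.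
Qed.

Lemma leq_ncardU (X : Type) (A B : set X) :
  finite_set A -> finite_set B -> (ncard (A `|` B) <= ncard A + ncard B)%N.
Proof.
move=> finA finB; rewrite (@ncard_fset {classic X});
  last by rewrite finite_setU.
by rewrite !(@ncard_fset {classic X}) // fset_setU // cardfsU leq_subr.
Qed.

(** Membership is [List.In] because [X] carries no equality test. *)
Lemma finite_set_seq (X : Type) (A : set X) :
  finite_set A -> exists s : seq X, forall x, A x <-> List.In x s.
Proof.
move=> /(@finite_seqP {classic X})[s ->]; exists s => x /=.
elim: s => [|y s IHs] /=; first by split.
rewrite in_cons; split=> [/orP[/eqP->|/IHs]|[->|/IHs ->]];
  rewrite ?eqxx ?orbT //.
  by left.
by right.
Qed.

Lemma finite_set_ind (X : Type) (P : set X -> Prop) :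
  P set0 ->
  (forall x A, finite_set A -> ~ A x -> P A -> P (x |` A)) ->
  forall A, finite_set A -> P A.
Proof.
move=> P0 PU A /(@finite_fsetP {classic X})[F ->].
elim/finSet_rect: F => F IHF; have [->|/fset0Pn[x xF]] := eqVneq F fset0.
  by rewrite set_fset0.
rewrite -(fsetD1K xF) set_fsetU1; apply: PU => //=.
- exact: (@finite_fset {classic X}).
- by rewrite in_fsetD1 eqxx.
- by apply: IHF; apply: fproperD1.
Qed.

(** Half of a double count: applied to a relation and to its transpose, it compares two sets whose
    fibres have different constant sizes. *)
Lemma ncard_fibres (X Y : Type) (R : set (X * Y)) (A : set X) k :
  finite_set A -> (forall z, R z -> A z.1) ->
  (forall x, A x -> finite_set [set y | R (x, y)] /\
    ncard [set y | R (x, y)] = k) ->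
  finite_set R /\ ncard R = (k * ncard A)%N.
Proof.
move=> finA; move: A finA R; apply: finite_set_ind =>
  [|x A finA nAx IH] R RA fibR.
  have -> : R = set0 by apply/seteqP; split => // z /RA.
  by rewrite !ncard_set0 muln0; split.
have [fx cx] := fibR x (or_introl erefl).
pose R1 := [set z | R z /\ A z.1].
have [fin1 c1] : finite_set R1 /\ ncard R1 = (k * ncard A)%N.
  apply: IH => [z []//|y Ay].
  have -> : [set y0 | R1 (y, y0)] = [set y0 | R (y, y0)].
    by apply/seteqP; split => u; [case | split].
  by apply: fibR; right.
pose R2 := (fun y => (x, y)) @` [set y | R (x, y)].
have fin2 : finite_set R2 by exact: finite_image.
have c2 : ncard R2 = k by rewrite ncard_image_inj // => u v _ _ [].
have disj : R1 `&` R2 = set0.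
  by apply/seteqP; split => // -[u v] [] [_ /= Au] [w _ [eqx _]];
    rewrite -eqx in Au.
have -> : R = R1 `|` R2.
  apply/seteqP; split => [[u v] Ruv|[u v] [[]//|[w Rw [<- <-]//]]].
  have /= [eqx|Ax] := RA _ Ruv; last by left.
  by right; exists v; rewrite /= -eqx.
split; first by rewrite finite_setU.
rewrite ncardU // c1 c2 ncardU //; last first.
  by apply/seteqP; split => // u [-> ].
by rewrite (ncard_eq card_set1) mulnDr muln1 addnC.
Qed.
End Cardinals.

(** * Subgroups of finite index *)

Section FiniteIndex.
Local Open Scope classical_set_scope.
Local Open Scope group_scope.
Variable gT : groupType.
Implicit Types (G H K S U V : set gT) (g h x y : gT).

Lemma is_subgroupP H :
  is_subgroup H <->
  [/\ H 1, forall x y, H x -> H y -> H (x * y) & forall x, H x -> H x^-1].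
Proof.
have memH x : (x \in mem H) = `[< H x >] by [].
split=> [cH|[H1 HM HV]].
  split=> [|x y Hx Hy|x Hx].
  - by case: cH => + _; rewrite memH => /asboolP.
  - by have := group_closedM cH; move/(_ x y); rewrite !memH => cM;
      apply/asboolP/cM; apply/asboolP.
  - by have := group_closedV cH; move/(_ x); rewrite !memH => cV;
      apply/asboolP/cV; apply/asboolP.
split; first by rewrite memH; apply/asboolP.
by move=> x y; rewrite !memH => /asboolP Hx /asboolP Hy; apply/asboolP/HM/HV.
Qed.

Lemma subgroup1 H : is_subgroup H -> H 1.
Proof. by case/is_subgroupP. Qed.

Lemma subgroupM H x y : is_subgroup H -> H x -> H y -> H (x * y).
Proof. by case/is_subgroupP => _ HM _; apply: HM. Qed.

Lemma subgroupV H x : is_subgroup H -> H x -> H x^-1.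
Proof. by case/is_subgroupP => _ _ HV; apply: HV. Qed.

Lemma subgroupT : is_subgroup [set: gT].
Proof. by apply/is_subgroupP. Qed.

Lemma subgroupI H K : is_subgroup H -> is_subgroup K -> is_subgroup (H `&` K).
Proof.
move=> sH sK; apply/is_subgroupP; split=> [|x y [] ? ? [] ? ?|x [] ? ?].
- by split; apply: subgroup1.
- by split; apply: subgroupM.
- by split; apply: subgroupV.
Qed.

Lemma sub_generated S : S `<=` generated S.
Proof. by move=> x Sx H [_]; apply. Qed.

Lemma generated_ind S H g : is_subgroup H -> S `<=` H -> generated S g -> H g.
Proof. by move=> sH SH; apply. Qed.

Lemma subgroup_generated S : is_subgroup (generated S).
Proof.
apply/is_subgroupP; split=> [|x y Sx Sy|x Sx] H [sH SH].
- exact: subgroup1.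
- by apply: subgroupM => //; [apply: Sx | apply: Sy].
- by apply: subgroupV => //; apply: Sx.
Qed.

Lemma translate1 U : translate 1 U = U.
Proof.
by apply/seteqP; split=> [x [u Uu <-]|x Ux]; [rewrite mul1g | exists x => //;
  rewrite mul1g].
Qed.

Lemma translateM g h U : translate (g * h) U = translate g (translate h U).
Proof.
apply/seteqP; split=> [x [u Uu <-]|x [_ [u Uu <-] <-]].
  by exists (h * u); [exists u | rewrite mulgA].
by exists u => //; rewrite mulgA.
Qed.

Lemma translate_eq H g h :
  is_subgroup H -> translate g H = translate h H <-> H (g^-1 * h).
Proof.
move=> sH; split=> [eqgh|Hgh].
  have [u Hu gu] : translate g H h.
    by rewrite eqgh; exists 1; [apply: subgroup1 | rewrite mulg1].
  by rewrite -gu mulKg.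
rewrite -{1}[g]mulg1; apply/seteqP; split=> x [u Hu <-].
  exists ((g^-1 * h)^-1 * u); first by apply: subgroupM => //; apply: subgroupV.
  by rewrite invgM invgK !mulgA mulgV mul1g mulg1.
exists (g^-1 * h * u); first exact: subgroupM.
by rewrite mulg1 !mulgA mulgV mul1g.
Qed.

(** The form in which finite index is usually proved below: an invariant with finitely many values
    that separates left cosets. It need not be constant on cosets, so [tau] may involve arbitrary
    choices. *)
Lemma finite_index_map (F : Type) (D : set F) (tau : gT -> F) H G :
  is_subgroup H -> finite_set D -> (forall g, G g -> D (tau g)) ->
  (forall g h, G g -> G h -> tau g = tau h -> H (g^-1 * h)) ->
  finite_index H G.
Proof.
move=> sH finD Dtau tauH.
pose c u := translate (xget 1 [set g | G g /\ tau g = u]) H.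
apply: sub_finite_set (finite_image c finD) => _ [g Gg <-].
exists (tau g); first exact: Dtau.
rewrite /c; apply/translate_eq => //.
by case: xgetP => [h _ [Gh eqh]|/(_ g)[]//]; apply: tauH.
Qed.

(** The representative is chosen from the coset as a set, which makes [r] constant on left
    cosets. *)
Lemma finite_index_rep H G : is_subgroup H -> finite_index H G ->
  exists r : gT -> gT,
    [/\ finite_set (r @` G), forall g, G g -> G (r g) /\ H ((r g)^-1 * g)
      & forall g h, H (g^-1 * h) -> r g = r h].
Proof.
move=> sH fin.
pose c C := xget 1 [set t | G t /\ translate t H = C].
exists (fun g => c (translate g H)); split=>
  [|g Gg|g h /(translate_eq _ _ sH)-> //].
  by apply: sub_finite_set (finite_image c fin) => _ [g Gg <-];
    exists (translate g H) => //; exists g.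
rewrite /c; case: xgetP => [t _ [Gt /(translate_eq _ _ sH)]//|/(_ g)[]//].
Qed.

Lemma finite_index_refl G : is_subgroup G -> finite_index G G.
Proof.
move=> sG; apply: (@finite_index_map unit setT (fun=> tt)) => // g h Gg Gh _.
by apply: subgroupM => //; apply: subgroupV.
Qed.

Lemma finite_index_super H K G : is_subgroup H -> is_subgroup K ->
  H `<=` K -> finite_index H G -> finite_index K G.
Proof.
move=> sH sK HK /(finite_index_rep sH)[r [finr rG rE]].
apply: (finite_index_map sK finr (tau := r)) => [g Gg|g h Gg Gh eqr];
  first by exists g.
have [_ /HK gr] := rG g Gg; have [_ /HK hr] := rG h Gh.
rewrite -(mulVKg (r g) h) mulgA; apply: subgroupM => //; last by rewrite eqr.
by have := subgroupV sK gr; rewrite invgM invgK.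
Qed.

Lemma finite_index_trans H K G : is_subgroup H -> is_subgroup K ->
  finite_index H K -> finite_index K G -> finite_index H G.
Proof.
move=> sH sK /(finite_index_rep sH)[r [finr rK rE]] /(finite_index_rep sK)[q
  [finq qG qE]].
apply: (@finite_index_map (gT * gT) _ (fun g =>
  (q g, r ((q g)^-1 * g))) _ _ sH (finite_setX finq finr)).
  move=> g Gg; split=> /=; first by exists g.
  by exists ((q g)^-1 * g) => //; have [] := qG g Gg.
move=> g h Gg Gh [eqq]; rewrite -eqq => eqr.
have [_ Kg] := qG g Gg; have [_] := qG h Gh; rewrite -eqq => Kh.
have [_ Hg] := rK _ Kg; have [_] := rK _ Kh; rewrite -eqr => Hh.
have := subgroupM sH (subgroupV sH Hg) Hh.
by rewrite !invgM !invgK !mulgA !mulgK.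
Qed.

Lemma finite_index_meet H K G : is_subgroup H -> is_subgroup K ->
  K `<=` G -> finite_index H G -> finite_index (H `&` K) K.
Proof.
move=> sH sK KG /(finite_index_rep sH)[r [finr rG rE]].
apply: (finite_index_map (subgroupI sH sK) finr (tau :=
  r)) => [g /KG Gg|g h Kg Kh eqr].
  by exists g.
split; last by apply: subgroupM => //; apply: subgroupV.
have [_ Hg] := rG g (KG _ Kg); have [_] := rG h (KG _ Kh); rewrite -eqr => Hh.
have := subgroupM sH (subgroupV sH Hg) Hh.
by rewrite !invgM !invgK !mulgA !mulgK.
Qed.

Lemma finite_indexI H K G : is_subgroup H -> is_subgroup K -> K `<=` G ->
  finite_index H G -> finite_index K G -> finite_index (H `&` K) G.
Proof.
move=> sH sK KG fH fK; apply: finite_index_trans (sK) (finite_index_meet sH sK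
  KG fH) fK.
exact: subgroupI.
Qed.

Lemma finite_index_big (I : Type) (s : seq I) (H : I -> set gT) G :
  is_subgroup G ->
  (forall i, List.In i s -> is_subgroup (H i) /\ finite_index (H i) G) ->
  let K := [set g | G g /\ forall i, List.In i s -> H i g] in
  is_subgroup K /\ finite_index K G.
Proof.
move=> sG; elim: s => [|i s IHs] /= sf.
  have -> : [set g | G g /\ forall i, False -> H i g] = G.
    by apply/seteqP; split => [g []//|g Gg]; split.
  by split=> //; apply: finite_index_refl.
have [sK fK] := IHs (fun j js => sf j (or_intror js)).
have [sHi fHi] := sf i (or_introl erefl).
have -> : [set g | G g /\ forall j, i = j \/ List.In j s -> H j g]
        = H i `&` [set g | G g /\ forall j, List.In j s -> H j g].
  apply/seteqP; split=> g.
    by case=> Gg Hg; split; [apply: Hg; left | split=> // j js; apply: Hg;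
      right].
  by case=> Hi [Gg Hg]; split=> // j [<-|/Hg].
split; first exact: subgroupI.
by apply: finite_indexI => // g [].
Qed.

(** Schreier's lemma: the elements of [U] compare [s * r c] with the representative of its coset. *)
Lemma finitely_generated_finite_index H G : is_subgroup G -> is_subgroup H ->
  H `<=` G -> finite_index H G -> finitely_generated G -> finitely_generated H.
Proof.
move=> sG sH HG /(finite_index_rep sH)[r [finr rG rE]] [S finS genS].
have rr g : G g -> r (r g) = r g by move=> /rG[_ /rE].
have SG : S `<=` G by rewrite -genS; apply: sub_generated.
pose U := (fun sc => (r (sc.1 * sc.2))^-1 * (sc.1 * sc.2)) @` (S `*` r @` G).
have U_H : U `<=` H.
  move=> _ [[s _] [/= /SG Gs [c Gc <-]] <-] /=.
  by have [] := rG (s * r c) (subgroupM sG Gs (proj1 (rG c Gc))).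
(* [r 1] is some element of [H], not necessarily [1]; it joins the generators in order to undo a
   conjugation by it at the end. *)
have Hr1 : H (r 1).
  have [_] := rG 1 (subgroup1 sG); rewrite mulg1 => /(subgroupV sH).
  by rewrite invgK.
have sUr : is_subgroup (generated (r 1 |` U)) by exact: subgroup_generated.
exists (r 1 |` U).
  by rewrite finite_setU; split => //; apply: finite_image; apply: finite_setX.
apply/seteqP; split=> h.
  by apply: generated_ind => // x [->//|/U_H].
move=> Hh.
(* The Schreier elements satisfy a cocycle rule, so those [g] for which all of them are generated
   form a subgroup. *)
pose L := [set g | G g /\ forall c, G c ->
  generated (r 1 |` U) ((r (g * r c))^-1 * (g * r c))].
have sL : is_subgroup L.
  apply/is_subgroupP; split=> [|g g' [Gg gc] [Gg' gc']|g [Gg gc]].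
  - split=> [|c Gc]; first exact: subgroup1.
    by rewrite mul1g rr // mulVg; apply: subgroup1.
  - split=> [|c Gc]; first exact: subgroupM.
    have Gc' : G (g' * r c) by apply: subgroupM => //; case: (rG c Gc).
    have := subgroupM sUr (gc _ Gc') (gc' c Gc).
    have -> : r (g * r (g' * r c)) = r (g * g' * r c).
      apply: rE; rewrite invgM -!mulgA; have [_] := rG _ Gc'.
      by rewrite mulKg.
    by rewrite !mulgA mulgK.
  - split=> [|c Gc]; first exact: subgroupV.
    have Gc' : G (g^-1 * r c).
      by apply: subgroupM => //; [apply: subgroupV | case: (rG c Gc)].
    have eqr : r (g * r (g^-1 * r c)) = r c.
      rewrite -{2}(rr c) //; apply: rE; rewrite invgM -!mulgA.
      by have [_] := rG _ Gc'.
    have := subgroupV sUr (gc _ Gc'); rewrite eqr.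
    by rewrite !invgM invgK !mulgA.
have SL : S `<=` L.
  move=> s Ss; split=> [|c Gc]; first exact: SG.
  by apply: sub_generated; right; exists (s, r c) => //; split=> //; exists c.
have [_ /(_ 1 (subgroup1 sG))] : L h by apply: (generated_ind sL SL);
  rewrite genS; apply: HG.
have -> : r (h * r 1) = r 1.
  rewrite (@rE (h * r 1) 1) //.
  by rewrite mulg1; apply: subgroupV => //; apply: subgroupM.
move=> gh; have g1 : generated (r 1 |` U) (r 1) by apply: sub_generated; left.
have := subgroupM sUr (subgroupM sUr g1 gh) (subgroupV sUr g1).
by rewrite !mulgA mulgV mul1g mulgK.
Qed.

Definition setprod U V : set gT :=
  [set g | exists u v, [/\ U u, V v & g = u * v]].

Section CommutingProduct.
Variables U V : set gT.
Hypotheses (sU : is_subgroup U) (sV : is_subgroup V).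
Hypothesis UV_comm : forall u v, U u -> V v -> u * v = v * u.

Lemma sub_setprodl : U `<=` setprod U V.
Proof.
by move=> u Uu; exists u, 1; rewrite mulg1; split=> //; apply: subgroup1.
Qed.

Lemma sub_setprodr : V `<=` setprod U V.
Proof.
by move=> v Vv; exists 1, v; rewrite mul1g; split=> //; apply: subgroup1.
Qed.

Lemma subgroup_setprod : is_subgroup (setprod U V).
Proof.
apply/is_subgroupP; split.
- by apply: sub_setprodl; apply: subgroup1.
- move=> _ _ [u [v [Uu Vv ->]]] [u' [v' [Uu' Vv' ->]]].
  exists (u * u'), (v * v'); split; try exact: subgroupM.
  by rewrite -!mulgA; congr (_ * _); rewrite !mulgA (UV_comm Uu' Vv).
- move=> _ [u [v [Uu Vv ->]]]; exists u^-1, v^-1; split; try exact: subgroupV.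
  by rewrite UV_comm // invgM.
Qed.

(** The product is direct, so projection to [U] is a homomorphism and the [U]-components of the
    generators suffice. *)
Lemma finitely_generated_setprodl :
  (forall g, U g -> V g -> g = 1) ->
  finitely_generated (setprod U V) -> finitely_generated U.
Proof.
move=> UV1 [S finS genS].
pose SU := [set u | U u /\ exists2 v, V v & S (u * v)].
have SUU : generated SU `<=` U by move=> u; apply: generated_ind => // ? [].
have uniq u v u' v' : U u -> V v -> U u' -> V v' -> u * v = u' * v' -> u = u'.
  move=> Uu Vv Uu' Vv' e; suff /UV1/(_ _) : U (u'^-1 * u).
    have -> : u'^-1 * u = v' * v^-1 by rewrite -(mulgK v u) e !mulgA mulVg
      mul1g.
    move=> /(_ (subgroupM sV Vv' (subgroupV sV Vv))) e1.
    by move: e; rewrite -[v'](mulgVK v) e1 mul1g => /mulIg.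
  by apply: subgroupM => //; apply: subgroupV.
exists SU.
  pose pi s := xget 1 [set u | U u /\ exists2 v, V v & s = u * v].
  apply: sub_finite_set (finite_image pi finS) => u [Uu [v Vv Suv]].
  exists (u * v) => //; rewrite /pi.
  case: xgetP => [u' _ [Uu' [v' Vv' e]]|/(_ u)[]]; last by split=> //; exists v.
  by apply: esym; apply: uniq e.
apply/seteqP; split=> // u Uu.
pose L := [set g | exists u v, [/\ generated SU u, V v & g = u * v]].
have sSU : is_subgroup (generated SU) by exact: subgroup_generated.
have sL : is_subgroup L.
  apply/is_subgroupP; split.
  - by exists 1, 1; split; rewrite ?mulg1 //; apply: subgroup1.
  - move=> _ _ [a [b [Ua Vb ->]]] [a' [b' [Ua' Vb' ->]]].
    exists (a * a'), (b * b'); split.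
    + exact: (subgroupM sSU).
    + exact: subgroupM.
    + by rewrite -!mulgA; congr (_ * _); rewrite !mulgA (UV_comm (SUU _ Ua')
      Vb).
  - move=> _ [a [b [Ua Vb ->]]]; exists a^-1, b^-1; split.
    + exact: (subgroupV sSU).
    + exact: subgroupV.
    + by rewrite (UV_comm (SUU _ Ua) Vb) invgM.
have SL : S `<=` L.
  move=> s Ss; have : setprod U V s by rewrite -genS; apply: sub_generated.
  case=> a [b [Ua Vb es]]; exists a, b; split=> //.
  by apply: sub_generated; split=> //; exists b => //; rewrite -es.
have : L u by apply: (generated_ind sL SL); rewrite genS; apply: sub_setprodl.
case=> a [b [Ua Vb eu]].
have -> // : u = a.
by apply: (uniq _ 1 _ b) => //; [apply: subgroup1 | apply: SUU | rewrite mulg1].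
Qed.

End CommutingProduct.
End FiniteIndex.

(** * Commensurated subsets *)

Section Action.
Local Open Scope classical_set_scope.
Local Open Scope group_scope.
Variables (gT : groupType) (X : Type) (act : gT -> X -> X).
Hypotheses (act1 : forall x, act 1 x = x)
  (actM : forall g h x, act (g * h) x = act g (act h x)).
Implicit Types (M P Q S : set gT) (g h p q : gT) (x y : X) (A B O : set X).

Lemma actK g : cancel (act g) (act g^-1).
Proof. by move=> x; rewrite -actM mulVg act1. Qed.

Lemma actVK g : cancel (act g^-1) (act g).
Proof. by move=> x; rewrite -actM mulgV act1. Qed.

Definition orb P x : set X := [set act p x | p in P].

(** The symmetric difference of [A] and its translate by [g^-1], written without an image so that
    propositional reasoning applies. *)
Definition moved A g : set X := [set x | ~ (A (act g x) <-> A x)].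

(** The boundary of [A] in the Schreier graph with edges from [x] to [act s x]. *)
Definition bd S A : set X := [set x | exists2 s, S s & moved A s x].

Definition preserved M O := forall g x, M g -> O x -> O (act g x).

Lemma displacementE A g : displacement act A g = moved A g^-1.
Proof.
have imE x : (act g @` A) x <-> A (act g^-1 x).
  by split=> [[y Ay <-]|Ax]; [rewrite actK | exists (act g^-1 x);
    rewrite ?actVK].
apply/seteqP; split=> x.
  by move=> [[/imE ? ?]|[? /imE ?]] [? ?]; tauto.
move=> nAx; have [Ax|Ax] := pselect (A x); [right|left]; split=> //.
  by move=> /imE ?; apply: nAx.
by apply/imE; apply: contrapT => nA; apply: nAx; tauto.
Qed.

Lemma commensuratedP M A : is_subgroup M ->
  commensurated M act A <-> forall g, M g -> finite_set (moved A g).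
Proof.
move=> sM; split=> cA g Mg.
  by have := cA g^-1 (subgroupV sM Mg); rewrite displacementE invgK.
by rewrite displacementE; apply: cA; apply: subgroupV.
Qed.

Lemma commensurated_sub M M' A :
  M `<=` M' -> commensurated M' act A -> commensurated M act A.
Proof. by move=> MM' cA g /MM' /cA. Qed.

Lemma finite_bd S M A : finite_set S -> is_subgroup M -> S `<=` M ->
  commensurated M act A -> finite_set (bd S A).
Proof.
move=> finS sM SM /(commensuratedP _ sM) cA.
have -> : bd S A = \bigcup_(s in S) moved A s by apply/seteqP; split=> x [s];
  exists s.
by apply: bigcup_finite => // s /SM /cA.
Qed.

Lemma moved_setC A g : moved (~` A) g = moved A g.
Proof.
apply/seteqP; split=> x nx AA; apply: nx; rewrite /setC /= in AA *;
  first by tauto.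
by split=> a; apply: contrapT; tauto.
Qed.

Lemma preserved_orb P x : is_subgroup P -> preserved P (orb P x).
Proof.
move=> sP g _ Pg [p Pp <-]; exists (g * p); last by rewrite actM.
exact: subgroupM.
Qed.

Lemma orb_refl P x : is_subgroup P -> orb P x x.
Proof. by move=> sP; exists 1; [apply: subgroup1 | rewrite act1]. Qed.

Lemma orb_eq P x y : is_subgroup P -> orb P x y -> orb P y = orb P x.
Proof.
move=> sP [p Pp <-]; apply/seteqP; split=> _ [q Pq <-].
  by exists (q * p); rewrite ?actM //; apply: subgroupM.
exists (q * p^-1); rewrite ?actM ?actK //.
by apply: subgroupM => //; apply: subgroupV.
Qed.

Lemma orb_disjoint P x y : is_subgroup P ->
  orb P x = orb P y \/ orb P x `&` orb P y = set0.
Proof.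
move=> sP; have [[z [xz yz]]|nz] := pselect (exists z, (orb P x `&` orb P y) z).
  by left; rewrite -(orb_eq sP xz) (orb_eq sP yz).
by right; apply/seteqP; split=> // z xyz; apply: nz; exists z.
Qed.

Lemma preservedE M O g x : is_subgroup M -> preserved M O -> M g ->
  O (act g x) <-> O x.
Proof.
move=> sM pO Mg; split=> [Ogx|]; last exact: pO.
by rewrite -(actK g x); apply: pO => //; apply: subgroupV.
Qed.

(** The elements that change membership in [A] nowhere on [O] form a subgroup, and it contains
    [S]. *)
Lemma generated_const S A O : preserved (generated S) O ->
  (forall x, O x -> ~ bd S A x) ->
  forall g x, generated S g -> O x -> A (act g x) <-> A x.
Proof.
move=> pO nbd g x Sg Ox.
have sS := subgroup_generated S.
pose L := [set g | generated S g /\ forall x, O x -> A (act g x) <-> A x].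
have sL : is_subgroup L.
  apply/is_subgroupP; split=> [|u v [Su uA] [Sv vA]|u [Su uA]].
  - by split=> [|y _]; [apply: subgroup1 | rewrite act1].
  - split=> [|y Oy]; first exact: (subgroupM sS).
    by rewrite actM uA ?vA //; apply: pO.
  - split=> [|y Oy]; first exact: (subgroupV sS).
    rewrite -uA ?actVK //; apply: pO => //; exact: (subgroupV sS).
have [_] : L g; last by apply.
apply: generated_ind Sg => // s Ss; split=> [|y Oy]; first exact: sub_generated.
by apply: contrapT => As; apply: (nbd _ Oy); exists s.
Qed.

Lemma moved_setI M A O g : is_subgroup M -> preserved M O -> M g ->
  moved (A `&` O) g = moved A g `&` O.
Proof.
move=> sM pO Mg; apply/seteqP; split=> x; rewrite /moved /= /setI /=;
  have := preservedE x sM pO Mg; last tauto.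
by move=> OO AO; split; [tauto | apply: contrapT; tauto].
Qed.

Lemma moved_setD M A O g : is_subgroup M -> preserved M O -> M g ->
  moved (A `\` O) g = moved A g `\` O.
Proof.
move=> sM pO Mg; apply/seteqP; split=> x; rewrite /moved /= /setD /=;
  have := preservedE x sM pO Mg; last tauto.
by move=> OO AO; split; tauto.
Qed.

Lemma commensurated_setI M A O : is_subgroup M -> preserved M O ->
  commensurated M act A -> commensurated M act (A `&` O).
Proof.
move=> sM pO /(commensuratedP _ sM) cA; apply/(commensuratedP _ sM) => g Mg.
by rewrite (moved_setI _ sM) //; apply: finite_setIl; apply: cA.
Qed.

Lemma commensurated_setD M A O : is_subgroup M -> preserved M O ->
  commensurated M act A -> commensurated M act (A `\` O).
Proof.
move=> sM pO /(commensuratedP _ sM) cA; apply/(commensuratedP _ sM) => g Mg.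
by rewrite (moved_setD _ sM) //; apply: finite_setD; apply: cA.
Qed.

Lemma nu_split M A O g : is_subgroup M -> preserved M O ->
  commensurated M act A -> M g ->
  nu act A g = (nu act (A `&` O) g + nu act (A `\` O) g)%N.
Proof.
move=> sM pO cA Mg; have finA := cA g Mg.
rewrite /nu !displacementE in finA *.
have MVg := subgroupV sM Mg.
rewrite (moved_setI _ sM) // (moved_setD _ sM) // -ncardU.
- by rewrite -{1}(setIT (moved A g^-1)) -(setUv O) setIUr setDE.
- exact: finite_setIl.
- exact: finite_setD.
- by apply/seteqP; split=> x // [[_ Ox] [_]].
Qed.

Lemma nu_set0 g : nu act set0 g = 0%N.
Proof.
rewrite /nu displacementE -[RHS](@ncard_set0 X); congr ncard.
by apply/seteqP; split=> x // nx; apply: nx.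
Qed.

(** [Phi] stays abstract because the same decomposition serves [virtual_sum] and [representable]. *)
Lemma nu_pieces M (Phi : (gT -> nat) -> Prop) (s : seq (set X)) A :
  is_subgroup M ->
  (forall f f', {in M, f =1 f'} -> Phi f -> Phi f') ->
  Phi (fun=> 0%N) ->
  (forall f f', Phi f -> Phi f' -> Phi (fun g => f g + f' g)%N) ->
  (forall O, List.In O s -> preserved M O) ->
  (forall O O', List.In O s -> List.In O' s -> O = O' \/ O `&` O' = set0) ->
  commensurated M act A ->
  (forall x, A x -> exists2 O, List.In O s & O x) ->
  (forall O, List.In O s -> Phi (nu act (A `&` O))) ->
  Phi (nu act A).
Proof.
move=> sM Phi_ext Phi0 PhiD.
elim: s A => [|O s IHs] A pO disjO cA covA PhiA.
  suff -> : A = set0 by apply: Phi_ext Phi0 => g _; rewrite nu_set0.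
  by apply/seteqP; split=> x // /covA[].
have pO1 := pO O (or_introl erefl).
have PhiD' : Phi (nu act (A `\` O)).
  apply: IHs => [O' sO'|O1 O2 s1 s2||x [Ax nOx]|O' sO'].
  - by apply: pO; right.
  - by apply: disjO; right.
  - exact: commensurated_setD cA.
  - by have [O' [<-//|sO' O'x]] := covA x Ax; exists O'.
  (* The list may repeat a piece; a later copy contributes nothing once [O] has been removed from
     [A]. *)
  have [<-|OO'] := disjO O O' (or_introl erefl) (or_intror sO').
    by rewrite setDKI; apply: Phi_ext Phi0 => g _; rewrite nu_set0.
  suff -> : (A `\` O) `&` O' = A `&` O' by apply: PhiA; right.
  apply/seteqP; split=> x [Ax O'x]; first by case: Ax.
  split=> //; split=> // Ox.
  by have : set0 x by rewrite -OO'.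
apply: (Phi_ext _ _ _ (PhiD _ _ (PhiA O (or_introl erefl)) PhiD')) => g Mg.
by rewrite (nu_split sM pO1 cA) //; move: Mg; rewrite inE.
Qed.

(** If [g] moves [x] across [B] but not across [A], the two sets differ at [x] or at [act g x];
    these two possibilities give the factor two in [nu_near]. *)
Lemma moved_near A B g :
  moved B g `<=` moved A g `|` ((A `+` B) `|` act g^-1 @` (A `+` B)).
Proof.
move=> x mBx; have [mAx|] := pselect (moved A g x); first by left.
move=> /contrapT AA; right.
have [Dx|nDx] := pselect ((A `+` B) x); first by left.
right; exists (act g x); last by rewrite actK.
apply: contrapT => nDgx; apply: mBx.
have dE y : ~ (A `+` B) y -> (A y <-> B y).
  move=> nD; split=> ?; apply: contrapT => ?; apply: nD; first by left.
  by right.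
have := dE _ nDx; have := dE _ nDgx; tauto.
Qed.

Lemma commensurated_near M A B : is_subgroup M -> finite_set (A `+` B) ->
  commensurated M act A -> commensurated M act B.
Proof.
move=> sM finD /(commensuratedP _ sM) cA; apply/(commensuratedP _ sM) => g Mg.
apply: sub_finite_set (@moved_near A B g) _.
by apply: finite_setUI; [apply: cA | apply: finite_setUI => //;
  apply: finite_image].
Qed.

Lemma nu_near A B g : finite_set (A `+` B) ->
  finite_set (displacement act A g) ->
  (nu act B g <= nu act A g + (ncard (A `+` B)).*2)%N.
Proof.
move=> finD; rewrite /nu !displacementE => finA.
have finI := finite_image (act g^-1^-1) finD.
have finU : finite_set ((A `+` B) `|` act g^-1^-1 @` (A `+` B)) by apply:
  finite_setUI.
apply: leq_trans (leq_ncard _ (@moved_near A B g^-1)) _;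
  first by apply: finite_setUI.
apply: leq_trans (leq_ncardU finA finU) _; rewrite leq_add2l.
apply: leq_trans (leq_ncardU finD finI) _; rewrite -addnn leq_add2l.
exact: leq_ncard_image.
Qed.

Lemma nu_finite A g : finite_set A -> (nu act A g <= (ncard A).*2)%N.
Proof.
move=> finA.
have fA : finite_set (set0 `+` A) by rewrite set0Y.
have : finite_set (displacement act set0 g).
  by rewrite displacementE; apply: sub_finite_set (finite_set0 X) => x; apply.
by move=> /(nu_near fA); rewrite nu_set0 set0Y.
Qed.

(** Inside an invariant set, [A] and its complement have the same displacement. *)
Lemma nu_cofinite M A O g : is_subgroup M -> preserved M O -> M g ->
  A `<=` O -> finite_set (O `\` A) -> (nu act A g <= (ncard (O `\` A)).*2)%N.
Proof.
move=> sM pO Mg AO finOA.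
suff -> : nu act A g = nu act (O `\` A) g by apply: nu_finite.
have MVg := subgroupV sM Mg.
rewrite /nu !displacementE; congr ncard.
have -> : O `\` A = ~` A `&` O by rewrite setIC setDE.
rewrite (moved_setI _ sM) // moved_setC; apply/seteqP; split=> x; last by case.
move=> mA; split=> //; apply: contrapT => nOx; apply: mA.
have := preservedE x sM pO MVg; have := AO x; have := AO (act g^-1 x); tauto.
Qed.

End Action.

(** * Sums of absolute values of homomorphisms on finite-index subgroups *)

Section VirtualSums.
Local Open Scope classical_set_scope.
Local Open Scope group_scope.
Variable gT : groupType.
Implicit Types (M : set gT) (f : gT -> nat) (s : seq (gT -> int)).

Definition additive_on M (phi : gT -> int) :=
  forall x y, M x -> M y -> phi (x * y) = (phi x + phi y)%R.

Definition sum_abs s (g : gT) : nat := \sum_(phi <- s) `|phi g|%N.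

(** The comparison is demanded on [M] only, so that such subgroups can be intersected freely;
    [representable_virtual_sum] recovers the whole group from subadditivity. *)
Definition virtual_sum f := exists M s C,
  [/\ is_subgroup M, finite_index M setT,
      forall phi, List.In phi s -> additive_on M phi
    & forall g, M g -> (f g <= sum_abs s g + C)%N /\
      (sum_abs s g <= f g + C)%N].

Lemma virtual_sum_near M f f' C : is_subgroup M -> finite_index M setT ->
  (forall g, M g -> (f g <= f' g + C)%N /\ (f' g <= f g + C)%N) ->
  virtual_sum f -> virtual_sum f'.
Proof.
move=> sM fM ff' [K [s [D [sK fK addK bndK]]]].
exists (M `&` K), s, (C + D)%N; split.
- exact: subgroupI.
- exact: finite_indexI.
- by move=> phi /addK addphi x y [_ Kx] [_ Ky]; apply: addphi.
- move=> g [/ff'[h1 h2] /bndK[h3 h4]]; lia.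
Qed.

Lemma virtual_sum_bounded M f C : is_subgroup M -> finite_index M setT ->
  (forall g, M g -> (f g <= C)%N) -> virtual_sum f.
Proof.
move=> sM fM bf; exists M, [::], C; split => // g Mg.
by rewrite /sum_abs big_nil; split; rewrite // add0n bf.
Qed.

Lemma virtual_sumD f f' :
  virtual_sum f -> virtual_sum f' -> virtual_sum (fun g => f g + f' g)%N.
Proof.
move=> [M [s [C [sM fM addM bndM]]]] [K [t [D [sK fK addK bndK]]]].
exists (M `&` K), (s ++ t), (C + D)%N; split.
- exact: subgroupI.
- exact: finite_indexI.
- move=> phi /(List.in_app_or s t)[/addM|/addK] addphi x y [Mx Kx] [My Ky];
    exact: addphi.
- move=> g [/bndM[h1 h2] /bndK[h3 h4]]; rewrite /sum_abs big_cat /=.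
  rewrite -/(sum_abs s g) -/(sum_abs t g); lia.
Qed.

Lemma virtual_sum_pieces (X : Type) (act : gT -> X -> X) M (s : seq (set X)) A :
  (forall x, act 1 x = x) ->
  (forall g h x, act (g * h) x = act g (act h x)) ->
  is_subgroup M -> finite_index M setT ->
  (forall O, List.In O s -> preserved act M O) ->
  (forall O O', List.In O s -> List.In O' s -> O = O' \/ O `&` O' = set0) ->
  commensurated M act A ->
  (forall x, A x -> exists2 O, List.In O s & O x) ->
  (forall O, List.In O s -> virtual_sum (nu act (A `&` O))) ->
  virtual_sum (nu act A).
Proof.
move=> act1 actM sM fM; apply: nu_pieces => // [f f' ff'||f f'].
- apply: (virtual_sum_near sM fM (C := 0%N)) => g Mg.
  by rewrite ff' ?inE // addn0.
- exact: (virtual_sum_bounded sM fM (C := 0%N)).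
- exact: virtual_sumD.
Qed.

End VirtualSums.

(** * Orbits under a product of commuting subgroups *)

Section Orbits.
Local Open Scope classical_set_scope.
Local Open Scope group_scope.
Variables (gT : groupType) (X : Type) (act : gT -> X -> X).
Hypotheses (act1 : forall x, act 1 x = x)
  (actM : forall g h x, act (g * h) x = act g (act h x)).
Implicit Types (M P Q S : set gT) (g h p q : gT) (x y : X) (A B O : set X).

Let actK := actK act1 actM.
Let actVK := actVK act1 actM.

Lemma orb_conj P P' m x : (forall p, P p -> P' (m * p * m^-1)) ->
  orb act P x `<=` act m^-1 @` orb act P' (act m x).
Proof.
move=> PP' _ [p Pp <-]; exists (act m (act p x)); last by rewrite actK.
by exists (m * p * m^-1); [apply: PP' | rewrite !actM actK].
Qed.

Lemma finite_orb_conj P P' m x : (forall p, P p -> P' (m * p * m^-1)) ->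
  finite_set (orb act P' (act m x)) -> finite_set (orb act P x).
Proof.
move=> PP' /(finite_image (act m^-1)).
by apply: sub_finite_set; apply: orb_conj.
Qed.

Lemma finite_orb_index P M x : is_subgroup P -> finite_index P M ->
  finite_set (orb act P x) -> finite_set (orb act M x).
Proof.
move=> sP /(finite_index_rep sP)[r [finr rM _]] fin.
apply: sub_finite_set (finite_image2 act finr fin) => _ [g Mg <-].
have [_ Pg] := rM g Mg.
exists (r g); first by exists g.
exists (act ((r g)^-1 * g) x); first by exists ((r g)^-1 * g).
by rewrite -actM mulVKg.
Qed.

Lemma sub_orb P M x : P `<=` M -> orb act P x `<=` orb act M x.
Proof. by move=> PM _ [p /PM Mp <-]; exists p. Qed.

Lemma finite_orb_setprod P Q x : is_subgroup P ->
  (forall p q, P p -> Q q -> p * q = q * p) ->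
  finite_set (orb act P x) -> finite_set (orb act Q x) ->
  finite_set (orb act (setprod P Q) x).
Proof.
move=> sP PQ finP finQ.
apply: (@sub_finite_set _ _ (\bigcup_(y in orb act Q x) orb act P y)).
  move=> _ [_ [p [q [Pp Qq ->]]] <-]; exists (act q x); first by exists q.
  by exists p; rewrite ?actM.
apply: bigcup_finite => // _ [q Qq <-].
apply: sub_finite_set (finite_image (act q) finP) => _ [p Pp <-].
by exists (act p x); [exists p | rewrite -!actM (PQ p q)].
Qed.

Section FewOrbits.
Variables (P Q S : set gT) (x0 : X).
Hypotheses (sP : is_subgroup P) (sQ : is_subgroup Q)
  (PQ_comm : forall p q, P p -> Q q -> p * q = q * p)
  (finS : finite_set S) (genS : generated S = P)
  (infP : infinite_set (orb act P x0)).
Let M := setprod P Q.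
Let Y := orb act M x0.

Let sM : is_subgroup M. Proof. exact: subgroup_setprod. Qed.
Let PM : P `<=` M. Proof. exact: sub_setprodl. Qed.
Let SM : S `<=` M. Proof. by move=> s Ss; apply: PM; rewrite -genS;
  apply: sub_generated. Qed.

Let normP m p : M m -> P p -> P (m * p * m^-1).
Proof.
move=> [u [v [Pu Qv ->]]] Pp.
rewrite invgM -!mulgA (mulgA v p) -(PQ_comm Pp Qv) -(mulgA p) mulVKg.
by apply: subgroupM => //; apply: subgroupM => //; apply: subgroupV.
Qed.

(** [P] is normal in [M], so [M] permutes the [P]-orbits in [Y]. Comparing each with one disjoint
    from [A], commensuration leaves finitely many points of [A] in it. As these orbits are infinite,
    those meeting [A] must meet its boundary. *)
Lemma finite_of_constant_orbit A y : commensurated M act A -> Y y ->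
  (forall z, orb act P y z -> ~ bd act S A z) -> ~ A y -> finite_set (A `&` Y).
Proof.
move=> cA Yy bdy nAy.
have pO z : preserved act (generated S) (orb act P z).
  by rewrite genS; apply: preserved_orb.
have Py z : orb act P y z -> ~ A z.
  move=> [p Pp <-]; rewrite (generated_const act1 actM (pO y) bdy) // ?genS //.
  exact: orb_refl.
have fin_orb y' : Y y' -> finite_set (A `&` orb act P y').
  move=> Yy'; have [m Mm <-] : orb act M y y' by rewrite (orb_eq act1 actM sM
    Yy).
  have MVm := subgroupV sM Mm.
  apply: sub_finite_set ((commensuratedP act1 actM A sM).1 cA _ MVm).
  move=> x [Ax [p Pp px]] [_ /(_ Ax)]; rewrite -px -!actM.
  apply: Py; exists (m^-1 * p * m); last by rewrite -!mulgA.
  by have := normP MVm Pp; rewrite invgK.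
apply: (@sub_finite_set _ _ (\bigcup_(z in bd act S A `&` Y) (A `&` orb act P
  z))).
  move=> a [Aa Ya]; have [[z [az bz]]|nz] :=
    pselect (exists z, orb act P a z /\ bd act S A z).
    exists z.
      split=> //; case: az => p Pp <-; apply: (preserved_orb actM) => //;
        exact: PM.
    split=> //; rewrite (orb_eq act1 actM sP az); exact: orb_refl.
  case: infP.
  have [m Mm ma] := Ya; apply: (finite_orb_conj (m := m) (P' := P)).
    by move=> p; apply: normP.
  rewrite ma; apply: sub_finite_set (fin_orb _ Ya) => z az; split=> //.
  case: az => p Pp <-; rewrite (generated_const act1 actM (pO a)) // ?genS //.
    by move=> w aw bw; apply: nz; exists w.
  exact: orb_refl.
apply: bigcup_finite; last by move=> z [_ Yz]; apply: fin_orb.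
by apply: finite_setIl; apply: (finite_bd act1 actM (M := M)).
Qed.

(** A [P]-orbit missing the boundary would make [A] or its complement finite in [Y], so the finite
    boundary meets them all. *)
Lemma few_orbits A : commensurated M act A ->
  infinite_set (A `&` Y) -> infinite_set (Y `\` A) ->
  exists2 D : set X, finite_set D &
    D `<=` Y /\ forall y, Y y -> exists2 z, D z & orb act P z y.
Proof.
move=> cA infA infCA; exists (bd act S A `&` Y).
  by apply: finite_setIl; apply: (finite_bd act1 actM (M := M)).
split=> [z []//|y Yy]; apply: contrapT => nz.
have bdy z : orb act P y z -> ~ bd act S A z.
  move=> yz bz; apply: nz; exists z.
    split=> //; case: yz => p Pp <-; apply: (preserved_orb actM) => //;
      exact: PM.
  rewrite (orb_eq act1 actM sP yz); exact: orb_refl.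
have [Ay|nAy] := pselect (A y); last exact/infA/(finite_of_constant_orbit cA
  Yy).
apply: infCA; rewrite setDE setIC.
apply: (finite_of_constant_orbit (y := y)) => //.
  apply/(commensuratedP act1 actM _ sM) => g Mg; rewrite moved_setC.
  exact: (commensuratedP act1 actM _ sM).1.
by move=> z /bdy; apply: contra_not => -[s Ss]; rewrite moved_setC; exists s.
Qed.

End FewOrbits.
End Orbits.

(** * Commuting actions and ends *)

Section TwoEnded.
Local Open Scope classical_set_scope.
Local Open Scope group_scope.
Variables (gT : groupType) (X : Type) (act : gT -> X -> X).
Hypotheses (act1 : forall x, act 1 x = x)
  (actM : forall g h x, act (g * h) x = act g (act h x)).
Variables (P Q S : set gT) (y0 : X).
Hypotheses (sP : is_subgroup P) (sQ : is_subgroup Q)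
  (PQ_comm : forall p q, P p -> Q q -> p * q = q * p)
  (finS : finite_set S) (genS : generated S = P).
Let O := orb act P y0.
Let M := setprod P Q.
Hypotheses (QO : preserved act Q O) (infQ : infinite_set (orb act Q y0)).
Implicit Types (g h p q : gT) (x y : X) (A B U V : set X).

Let actK := actK act1 actM.
Let actVK := actVK act1 actM.
Let sM : is_subgroup M. Proof. exact: subgroup_setprod. Qed.
Let PM : P `<=` M. Proof. exact: sub_setprodl. Qed.
Let QM : Q `<=` M. Proof. exact: sub_setprodr. Qed.
Let SP : S `<=` P. Proof. by rewrite -genS; apply: sub_generated. Qed.
Let PO : preserved act P O. Proof. exact: preserved_orb. Qed.
Let Oy0 : O y0. Proof. exact: orb_refl. Qed.
Let MO : preserved act M O.
Proof.
by move=> _ x [p [q [Pp Qq ->]]] Ox; rewrite actM; apply: PO => //; apply: QO.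
Qed.

Let actPQ p q x : P p -> Q q -> act p (act q x) = act q (act p x).
Proof. by move=> Pp Qq; rewrite -!actM PQ_comm. Qed.

(** [Q] acts on the transitive [P]-set [O] by automorphisms, and these are determined by one
    value. *)
Lemma commuting_eq q q' x y : Q q -> Q q' -> O x -> O y ->
  act q x = act q' x -> act q y = act q' y.
Proof.
move=> Qq Qq' [p Pp <-] [p' Pp' <-] e.
rewrite -(mulgVK p p') [in act q _]actM [in act q' _]actM.
have Pr : P (p' / p) by apply: subgroupM => //; apply: subgroupV.
by rewrite -!(actPQ _ Pr) // e.
Qed.

Lemma constant_on_orbit A x y : (forall x, O x -> ~ bd act S A x) ->
  O x -> O y -> A x -> A y.
Proof.
move=> nbd [p Pp <-] [p' Pp' <-] Ax.
rewrite -(mulgVK p p') actM.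
rewrite (generated_const act1 actM (S := S) (O := O)) ?genS //.
- by apply: subgroupM => //; apply: subgroupV.
- by exists p.
Qed.

(** [L] stands for a path from [y] to [act p y]; its connectedness is recorded through the one
    consequence used, about sets whose boundary avoids it. *)
Lemma finite_path p y : P p -> O y -> exists L : set X,
  [/\ finite_set L, L `<=` O, L y, L (act p y)
    & forall A, (forall x, L x -> ~ bd act S A x) ->
        forall x, L x -> A x <-> A y].
Proof.
move=> Pp; move: y.
pose T := [set p | P p /\ forall y, O y -> exists L : set X,
  [/\ finite_set L, L `<=` O, L y, L (act p y)
    & forall A, (forall x, L x -> ~ bd act S A x) ->
        forall x, L x -> A x <-> A y]].
suff : T p by case.
move: Pp; rewrite -genS; apply: generated_ind.
  apply/is_subgroupP; split.
  - split=> [|y Oy]; first exact: subgroup1.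
    exists [set y]; rewrite act1; split=> // [x ->//|A _ x ->//].
  - move=> a b [Pa Ta] [Pb Tb]; split=> [|y Oy]; first exact: subgroupM.
    have [L [fL LO Ly Lby LA]] := Tb y Oy.
    have [K [fK KO Kby Kaby KA]] := Ta _ (PO Pb Oy).
    exists (L `|` K); split.
    + exact: finite_setUI.
    + by move=> x [/LO|/KO].
    + by left.
    + by right; rewrite actM.
    + move=> A nA x [Lx|Kx]; first by apply: LA => // z Lz; apply: nA; left.
      rewrite -(LA A _ _ Lby); last by move=> z Lz; apply: nA; left.
      by apply: KA => // z Kz; apply: nA; right.
  - move=> a [Pa Ta]; split=> [|y Oy]; first exact: subgroupV.
    have [L [fL LO Ly Lay LA]] := Ta _ (PO (subgroupV sP Pa) Oy).
    rewrite actVK in Lay; exists L; split=> // A nA x Lx.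
    by rewrite (LA A nA x Lx) (LA A nA y Lay).
move=> s Ss; split=> [|y Oy]; first exact: SP.
exists [set y; act s y]; split.
- exact: finite_set2.
- by move=> x [->//|->]; apply: PO => //; apply: SP.
- by left.
- by right.
- move=> A nA x [->//|->]; apply: contrapT => mA.
  by apply: (nA y); [left | exists s].
Qed.

Lemma finite_connected (F : set X) : finite_set F -> F `<=` O ->
  exists Y0 : set X, [/\ finite_set Y0, Y0 `<=` O, F `<=` Y0, Y0 y0
    & forall A, (forall x, Y0 x -> ~ bd act S A x) ->
        forall x, Y0 x -> A x <-> A y0].
Proof.
move: F; apply: finite_set_ind => [_|x F finF _ IH FO].
  by exists [set y0]; split=> // [x ->//|A _ x ->].
have [|Y0 [fY YO FY Yy0 YA]] := IH; first by move=> z Fz; apply: FO; right.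
have [p Pp px] : O x by apply: FO; left.
have [L [fL LO Ly0 Lx LA]] := finite_path Pp Oy0.
exists (Y0 `|` L); split.
- exact: finite_setUI.
- by move=> z [/YO|/LO].
- by move=> z [->|/FY]; [right; rewrite -px | left].
- by left.
- by move=> A nA z [Yz|Lz]; [apply: YA | apply: LA] => // w ?; apply: nA;
  [left|right].
Qed.

(** If [q] sends some [x] of [Y0] into [Y0], the pair formed by [x] and [act q x] determines
    [act q y0], since [q] commutes with an element of [P] taking [y0] to [x]. If every [q] did so,
    the orbit of [y0] under [Q] would be finite. *)
Lemma moving_off (Y0 : set X) : finite_set Y0 -> Y0 `<=` O ->
  exists2 q, Q q & forall x, Y0 x -> ~ Y0 (act q x).
Proof.
move=> finY YO; apply: contrapT => nq; apply: infQ.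
pose c x := xget 1 [set p | P p /\ act p y0 = x].
have cP x : O x -> P (c x) /\ act (c x) y0 = x.
  by move=> [p Pp px]; rewrite /c; case: xgetP => [? _ //|/(_ p)[]].
apply: sub_finite_set (finite_image2 (fun x y => act (c x)^-1 y) finY finY) =>
  _ [q Qq <-].
have [x [Yx Yqx]] : exists x, Y0 x /\ Y0 (act q x).
  apply: contrapT => nx; apply: nq; exists q => // x Yx Yqx.
  by apply: nx; exists x.
exists x => //; exists (act q x) => //.
have [Pc e] := cP x (YO _ Yx).
by rewrite -{2}e -(actPQ _ Pc) // actK.
Qed.

Section Commensurated.
Variable B : set X.
Hypotheses (cB : commensurated M act B) (BO : B `<=` O)
  (infB : infinite_set B) (infCB : infinite_set (O `\` B)).

Let finbd : finite_set (bd act S B `&` O).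
Proof.
apply: finite_setIl; apply: (finite_bd act1 actM (M := M)) => // s /SP;
  exact: PM.
Qed.

Let exB : exists2 x, O x & B x.
Proof. by have [x Bx] := infinite_setN0 infB; exists x => //; apply: BO. Qed.

Let exCB : exists2 x, O x & ~ B x.
Proof. by have [x [Ox Bx]] := infinite_setN0 infCB; exists x. Qed.

(* When [q] carries a connected finite set containing the boundary of [B] off
   itself, one of the four corners of [B] and [q B] has empty boundary. *)
Lemma shifting_element : exists2 z, Q z &
  (forall x, O x -> B (act z^-1 x) -> B x) /\
  exists2 x, O x & B x /\ ~ B (act z^-1 x).
Proof.
have [Y0 [fY YO bdY Yy0 YA]] := finite_connected finbd (@subIsetr _ _ _).
have [q Qq qY] := moving_off fY YO.
have QVq := subgroupV sQ Qq.
(* [V] is the translate [q B]. Its boundary lies in [q Y0], disjoint from [Y0], so [V] is constant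
   on [Y0]; likewise [B] is constant on [q Y0]. *)
pose V := [set x | B (act q^-1 x)].
have mV s x : P s -> moved act V s x <-> moved act B s (act q^-1 x).
  by move=> Ps; rewrite /moved /V /= (actPQ x Ps QVq).
have bdV x : O x -> bd act S V x -> Y0 (act q^-1 x).
  move=> Ox [s Ss] /(mV _ _ (SP Ss)) mB; apply: bdY; split; first by exists s.
  exact: QO.
have Boff s x : S s -> O x -> ~ Y0 x -> (B (act s x) <-> B x).
  move=> Ss Ox nY; apply: contrapT => mB; apply: nY; apply: bdY; split=> //.
  by exists s.
have Voff s x : S s -> O x -> ~ Y0 (act q^-1 x) -> (V (act s x) <-> V x).
  by move=> Ss Ox nY; apply: contrapT => mV'; apply: nY; apply: bdV => //;
    exists s.
have nYV x : Y0 x -> ~ Y0 (act q^-1 x) by move=> Yx /qY; rewrite actVK.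
have VY x : Y0 x -> (V x <-> V y0).
  by apply: YA => z Yz /bdV-/(_ (YO _ Yz)); apply: nYV.
have BqY x : O x -> Y0 (act q^-1 x) -> (B x <-> B (act q y0)).
  pose U := [set x | B (act q x)].
  have UY w : Y0 w -> (U w <-> U y0).
    apply: YA => z Yz [s Ss mU]; apply: (qY z Yz); apply: bdY; split.
      by exists s => //; rewrite /moved /= actPQ //; apply: SP.
    by apply: QO => //; apply: YO.
  by move=> Ox /UY; rewrite /U /= actVK.
pose b0 := B (act q y0); pose v0 := V y0.
(* No edge crosses this corner: one starting in [Y0] keeps [V] equal to [v0], one starting in [q Y0]
   keeps [B] equal to [b0], and any other changes neither. *)
pose T := [set x | (B x <-> ~ b0) /\ (V x <-> ~ v0)].
have nT x : O x -> ~ bd act S T x.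
  move=> Ox [s Ss]; apply.
  have [Yx|nYx] := pselect (Y0 x).
    have := VY x Yx; have := Voff s x Ss Ox (nYV x Yx).
    rewrite /T /= -/v0; tauto.
  have Bs := Boff s x Ss Ox nYx.
  have [Yqx|nYqx] := pselect (Y0 (act q^-1 x)).
    have := BqY x Ox Yqx; rewrite /T /= -/b0; tauto.
  by have := Voff s x Ss Ox nYqx; rewrite /T /=; tauto.
have Tconst x y : O x -> O y -> T x -> T y by exact: constant_on_orbit.
have finq : finite_set (moved act B q^-1).
  exact: ((commensuratedP act1 actM B sM).1 cB _ (QM QVq)).
have dB x : ~ moved act B q^-1 x -> (V x <-> B x) by move=> /contrapT.
(* A common boundary point of [B] and [V] would lie in both [Y0] and [q Y0]. *)
have strict : ~ (forall x, O x -> V x <-> B x).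
  move=> VB; have [x Ox bx] : exists2 x, O x & bd act S B x.
    apply: contrapT => nb; have [x Ox Bx] := exB; have [y Oy nBy] := exCB.
    apply: nBy; apply: constant_on_orbit Bx => // z Oz bz.
    by apply: nb; exists z.
  have Yx : Y0 x by apply: bdY.
  apply: (nYV x Yx); apply: bdV => //.
  case: bx => s Ss mB; exists s => //; rewrite /moved /= !VB //.
  by apply: PO => //; apply: SP.
have [TO|TN] := pselect (exists2 x, O x & T x).
  have [x Ox Tx] := TO.
  have allT y : O y -> T y by move=> Oy; apply: Tconst Tx.
  have [y Oy By] := exB; have [w Ow nBw] := exCB.
  by have := (allT y Oy).1; have := (allT w Ow).1; tauto.
have nTx x : O x -> ~ T x by move=> Ox Tx; apply: TN; exists x.
(* Now [T] is empty on [O]. If [b0] and [v0] agree, [B] or its complement lies in the finite set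
   where [B] and [V] differ. Otherwise one of [B] and [V] contains the other, which decides between
   [q] and [q^-1]. *)
have [bv|bv] := pselect (b0 <-> v0).
  have [b|nb] := pselect b0.
    case: infCB; apply: sub_finite_set finq => x [Ox nBx].
    apply: contrapT => /dB VB; apply: (nTx x Ox); rewrite /T /=; tauto.
  case: infB; apply: sub_finite_set finq => x Bx.
  apply: contrapT => /dB VB; apply: (nTx x (BO Bx)); rewrite /T /=; tauto.
have [b|nb] := pselect b0.
  exists q => //; split.
    move=> x Ox Vx; apply: contrapT => nBx; apply: (nTx x Ox).
    by rewrite /T /=; have : V x by []; tauto.
  apply: contrapT => ns; apply: strict => x Ox; split=> [Vx|Bx].
    apply: contrapT => nBx; apply: (nTx x Ox); rewrite /T /=; tauto.
  by apply: contrapT => nVx; apply: ns; exists x.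
exists q^-1 => //; rewrite invgK.
have BV x : O x -> B x -> V x.
  move=> Ox Bx; apply: contrapT => nVx; apply: (nTx x Ox); rewrite /T /=; tauto.
split.
  by move=> x Ox Bqx; have := BV _ (QO Qq Ox) Bqx; rewrite /V /= actK.
apply: contrapT => ns; apply: strict => x Ox; split=> [Vx|]; last exact: BV.
apply: contrapT => nBx; apply: ns; exists (act q^-1 x); first exact: QO.
by rewrite actVK.
Qed.

End Commensurated.

Lemma finite_pigeonhole (f : nat -> X) (F : set X) : finite_set F ->
  (forall n, F (f n)) -> exists n m, (n < m)%N /\ f n = f m.
Proof.
move=> finF Ff; apply: contrapT => ninj.
have injf : injective f.
  move=> n m e; case: (ltngtP n m) => // lt; exfalso; apply: ninj.
    by exists n, m.
  by exists m, n.
apply: infinite_nat.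
have /card_esym : (f @` setT #= [set: nat])%card by apply: inj_card_eq =>
  ? ? _ _; apply: injf.
move=> /eq_finite_set ->.
by apply: sub_finite_set finF => _ [n _ <-].
Qed.

(** The set of points that stay in [B] forever has empty boundary: all late iterates of a boundary
    point would lie on the finite boundary of [B], so a positive power of [w] would fix a point,
    hence all of [O], against strictness. *)
Lemma escapes B w : Q w -> finite_set (bd act S B `&` O) ->
  (forall x, O x -> B (act w x) -> B x) ->
  (exists2 x, O x & B x /\ ~ B (act w x)) ->
  (exists2 x, O x & ~ B x) ->
  forall x, O x -> exists n, ~ B (act (w ^+ n) x).
Proof.
move=> Qw finb wB [u Ou [Bu nBu]] [v Ov nBv].
have Qn n : Q (w ^+ n).
  elim: n => [|n IHn]; first exact: subgroup1.
  by rewrite expgS; apply: subgroupM.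
have wnB n x : O x -> B (act (w ^+ n) x) -> B x.
  elim: n => [|n IHn] Ox; first by rewrite act1.
  by rewrite expgS actM => /wB Bx; apply: IHn => //; apply: Bx; apply: QO.
have mono n m x : O x -> (n <= m)%N -> B (act (w ^+ m) x) -> B (act (w ^+ n) x).
  by move=> Ox /subnK <-; rewrite expgnDr actM; apply: wnB; apply: QO.
pose T := [set x | forall n, B (act (w ^+ n) x)].
have nT x : O x -> ~ bd act S T x.
  move=> Ox [s Ss mT].
  have Osx : O (act s x) by apply: PO => //; apply: SP.
  have [N bN] : exists N, forall n, bd act S B (act (w ^+ (n + N)) x).
    have [Tx|nTx] := pselect (T x).
      have /existsNP[N nN] : ~ T (act s x) by move=> Tsx; apply: mT; split.
      exists N => n; exists s => // e; apply: nN.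
      apply: (mono _ (n + N)%N) => //; first exact: leq_addl.
      by rewrite -actPQ //; [apply/e | apply: SP].
    have Tsx : T (act s x) by apply: contrapT => nTsx; apply: mT; split.
    have /existsNP[N nN] := nTx.
    exists N => n; exists s => // e; apply: nN.
    apply: (mono _ (n + N)%N) => //; first exact: leq_addl.
    by apply/e; rewrite actPQ //; apply: SP.
  have [n [m [ltnm e]]] := finite_pigeonhole finb (fun n =>
    conj (bN n) (QO (Qn _) Ox)).
  have {e} e : act (w ^+ (m + N)) x = act 1 (act (w ^+ (n + N)) x) by rewrite
    act1 e.
  have eD : (m + N = (m - n) + (n + N))%N by lia.
  rewrite eD expgnDr actM in e.
  have := commuting_eq (y := u) (Qn (m - n)%N) (subgroup1 sQ) (QO (Qn (n + N)%N)
    Ox) Ou e.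
  rewrite act1 => eu; apply: nBu.
  by rewrite -[w]expg1; apply: (mono _ (m - n)%N) => //; [lia | rewrite eu].
move=> x Ox; apply/existsNP => Tx; apply: nBv.
by have /(_ 0%N) := constant_on_orbit nT Ox Ov Tx; rewrite act1.
Qed.

(** * Disjoint translates of a finite set by the powers of one element *)

Section Strip.
Variable z : gT.

Definition zpow (k : int) : gT :=
  match k with Posz n => z ^+ n | Negz n => z ^- n.+1 end.

Lemma zpowS k : zpow (k + 1)%R = z * zpow k.
Proof.
case: k => [n|[|n]].
- by rewrite -PoszD addn1 /= expgS.
- by rewrite NegzE addNr /= expg1 mulgV.
- have -> : (Negz n.+1 + 1 = Negz n)%R by rewrite !NegzE; lia.
  by rewrite /= (expgSr z n.+1) invgM mulVKg.
Qed.

Lemma zpowD k l : zpow (k + l)%R = zpow k * zpow l.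
Proof.
elim/int_ind: k => [|n IHn|n IHn]; first by rewrite add0r /= mul1g.
  by rewrite -addn1 PoszD -addrA (addrC 1%R) addrA !zpowS IHn mulgA.
apply: (mulgI z); rewrite -zpowS mulgA -zpowS.
have -> : (- n.+1%:Z + 1 = - n%:Z)%R by lia.
by rewrite -IHn; congr zpow; lia.
Qed.

Lemma zpowN k : zpow (- k)%R = (zpow k)^-1.
Proof. by apply: (mulIg (zpow k)); rewrite -zpowD addNr mulVg. Qed.

Lemma zpow_mem H k : is_subgroup H -> H z -> H (zpow k).
Proof.
move=> sH Hz; have HX n : H (z ^+ n).
  by elim: n => [|n IHn]; [apply: subgroup1 | rewrite expgS; apply: subgroupM].
by case: k => n //=; apply: subgroupV.
Qed.

Variable B : set X.
Hypotheses (Qz : Q z) (cB : commensurated M act B) (BO : B `<=` O).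
Hypothesis (zB : forall x, O x -> B (act z^-1 x) -> B x).
Hypothesis below : forall x, O x -> exists n, ~ B (act (z^-1 ^+ n) x).
Hypothesis above : forall x, O x -> exists n, B (act (z ^+ n) x).

Let Qzp k : Q (zpow k). Proof. exact: zpow_mem. Qed.
Let Ozp k x : O x -> O (act (zpow k) x). Proof. exact: QO. Qed.

Let zpB k l x : O x -> (k <= l)%R -> B (act (zpow k) x) -> B (act (zpow l) x).
Proof.
move=> Ox lekl; have -> : (l = k + `|l - k|%N)%R by lia.
elim: `|l - k|%N => [|n IHn] Bk; first by rewrite addr0.
apply: zB; first exact: Ozp.
by rewrite -addn1 PoszD addrA zpowS actM actK; apply: IHn.
Qed.

(** A finite fundamental domain for the powers of [z] on [O]; its translates by nonnegative powers
    make up [B]. *)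
Definition fundamental : set X := [set x | B x /\ ~ B (act z^-1 x)].
Let W := fundamental.

Let WO w : W w -> O w. Proof. by case=> /BO. Qed.

Let finW : finite_set W.
Proof.
apply: sub_finite_set ((commensuratedP act1 actM B sM).1 cB z^-1 _).
  by move=> x [Bx nBx] e; apply: nBx; apply/e.
by apply: QM; apply: subgroupV.
Qed.

Let B_W k w : W w -> B (act (zpow k) w) <-> (0 <= k)%R.
Proof.
move=> Ww; have [Bw nBw] := Ww; split=> [Bk|k0].
  rewrite leNgt; apply/negP => k0; apply: nBw.
  have -> : z^-1 = zpow (-1)%R by rewrite (zpowN 1%R).
  by apply: zpB Bk; [apply: WO | lia].
by apply: (zpB (k := 0%R)) => //; [apply: WO | rewrite act1].
Qed.

Let zpW_le k l w w' : W w -> W w' ->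
  act (zpow k) w = act (zpow l) w' -> (l <= k)%R.
Proof.
move=> Ww Ww' e; rewrite -subr_ge0 addrC -(B_W _ Ww) zpowD actM e -actM -zpowD
  addNr act1.
by case: Ww'.
Qed.

Let zpW_inj k l w w' : W w -> W w' ->
  act (zpow k) w = act (zpow l) w' -> k = l /\ w = w'.
Proof.
move=> Ww Ww' e; have ekl : k = l.
  by apply/eqP; rewrite eq_le (zpW_le Ww' Ww (esym e)) (zpW_le Ww Ww' e).
by split=> //; move: e; rewrite ekl => /(can_inj (actK _)).
Qed.

(** Move [x] up into [B], then down to the last position still in [B]. *)
Let coverW x : O x -> exists k w, W w /\ x = act (zpow k) w.
Proof.
move=> Ox; have [a Ba] := above Ox.
have Oax : O (act (z ^+ a) x) by exact: (Ozp a).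
have [n0 nBn0] := below Oax.
have exn : exists n, `[< ~ B (act (z^-1 ^+ n) (act (z ^+ a) x)) >].
  by exists n0; apply/asboolP.
case: (ex_minnP exn) => n /asboolP nBn minn.
case: n nBn minn => [|n] nBn minn; first by case: nBn; rewrite act1.
have zVE m : z^-1 ^+ m = zpow (- m%:Z)%R by rewrite zpowN /= expVgn.
exists (n%:Z - a%:Z)%R, (act (z^-1 ^+ n) (act (z ^+ a) x)); split.
  split; last by rewrite -actM -expgS.
  apply: contrapT => nB; have := minn n (introT (asboolP _) nB); lia.
rewrite zVE -[z ^+ a]/(zpow a%:Z) -!actM -!zpowD.
by rewrite (_ : (_ + _)%R = 0%R) ?act1 //; lia.
Qed.

Let C := [set g | M g /\ forall x, O x -> act g (act z x) = act z (act g x)].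

Let sC : is_subgroup C.
Proof.
apply/is_subgroupP; split.
- by split=> [|x Ox]; [apply: subgroup1 | rewrite !act1].
- move=> g h [Mg gz] [Mh hz]; split=> [|x Ox]; first exact: subgroupM.
  by rewrite !actM hz // gz //; apply: MO.
- move=> g [Mg gz]; split=> [|x Ox]; first exact: subgroupV.
  apply: (can_inj (actK g)); rewrite actVK gz ?actVK //.
  by apply: MO => //; apply: subgroupV.
Qed.

Let Czp g k x : C g -> O x -> act g (act (zpow k) x) = act (zpow k) (act g x).
Proof.
move=> Cg Ox; pose D := [set q | Q q /\ forall x, O x ->
  act g (act q x) = act q (act g x)].
have Og y : O y -> O (act g y) by apply: MO; case: Cg.
suff [_] : D (zpow k) by apply.
apply: zpow_mem; last by split=> //; case: Cg.
apply/is_subgroupP; split.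
- by split=> [|y Oy]; [apply: subgroup1 | rewrite !act1].
- move=> a b [Qa aD] [Qb bD]; split=> [|y Oy]; first exact: subgroupM.
  by rewrite !actM aD ?bD //; apply: QO.
- move=> a [Qa aD]; split=> [|y Oy]; first exact: subgroupV.
  apply: (can_inj (actK a)); rewrite actVK -aD ?actVK //.
  by apply: QO => //; apply: subgroupV.
Qed.

(** The invariant of [p * q] is the line of powers of [z] through [act q^-1 y0], named by its point
    in [W]. If [q] and [q'] give the same line, [q^-1 * q'] acts on [O] as a power of [z], which
    commutes with [z]. *)
Let fC : finite_index C M.
Proof.
pose R g w := W w /\ exists p q k, [/\ P p, Q q, g = p * q
  & act q^-1 y0 = act (zpow k) w].
apply: (finite_index_map (F := {classic X}) sC finW
  (tau := fun g => xget (y0 : {classic X}) (R g))).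
  move=> g [p [q [Pp Qq ->]]]; case: xgetP => [w _ []//|].
  have [|k [w [Ww e]]] := coverW (x := act q^-1 y0).
    by apply: QO => //; apply: subgroupV.
  by move=> /(_ w)[]; split=> //; exists p, q, k.
have exR g : M g -> exists w, R g w.
  move=> [p [q [Pp Qq ->]]].
  have [|k [w [Ww e]]] := coverW (x := act q^-1 y0).
    by apply: QO => //; apply: subgroupV.
  by exists w; split=> //; exists p, q, k.
move=> g h /[dup] Mg /exR[w Rgw] /[dup] Mh /exR[w' Rhw'].
case: xgetP => [u _ Rgu|/(_ w)//]; case: xgetP => [v _ Rhv|/(_ w')//] e.
move: e Rgu Rhv => <- {v} [Ww [p [q [k [Pp Qq ->
  eq]]]]] [_ [p' [q' [k' [Pp' Qq' -> eq']]]]].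
have QVq := subgroupV sQ Qq; have QVq' := subgroupV sQ Qq'.
have Pr : P (p^-1 * p') by apply: subgroupM => //; apply: subgroupV.
have -> : (p * q)^-1 * (p' * q') = (p^-1 * p') * (q^-1 * q').
  by rewrite invgM !mulgA -(mulgA q^-1) -(PQ_comm Pr QVq).
have Cr : C (p^-1 * p').
  by split=> [|x Ox]; [apply: PM | rewrite actPQ].
apply: subgroupM Cr _ => //; split=> [|x Ox]; first by apply: QM;
  apply: subgroupM.
have shift y : O y -> act (q^-1 * q') y = act (zpow (k - k')%R) y.
  move=> Oy; rewrite actM -[in RHS](actK q' y) -[in RHS]actM.
  apply: (commuting_eq (x := y0)) => //; [exact: subgroupM | exact: QO |].
  by rewrite actM eq' -actM -zpowD subrK.
rewrite !shift //; last exact: QO.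
by rewrite -!actM -zpowS (zpowD _ 1%R).
Qed.

Let strand w := [set x | exists k, x = act (zpow k) w].

Let K := [set g | C g /\ forall w, W w -> strand w (act g w)].

(** Elements of [C] permute the finitely many strands, so preserving each of them costs only a
    finite index. *)
Let sK_fK : is_subgroup K /\ finite_index K M.
Proof.
have [s sP'] := finite_set_seq finW.
have idx w : W w -> is_subgroup [set g | C g /\ strand w (act g w)] /\
    finite_index [set g | C g /\ strand w (act g w)] C.
  move=> Ww; have Ow := WO Ww.
  have sH : is_subgroup [set g | C g /\ strand w (act g w)].
    apply/is_subgroupP; split.
    - split; first exact: subgroup1.
      by exists 0%R.
    - move=> g h [Cg [k gk]] [Ch [l hl]]; split; first exact: subgroupM.
      by exists (l + k)%R; rewrite actM hl Czp // gk zpowD actM.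
    - move=> g [Cg [k gk]]; split; first exact: subgroupV.
      exists (- k)%R; apply: (can_inj (actK g)).
      by rewrite actVK Czp // gk -actM -zpowD addNr act1.
  split=> //.
  pose R g w' := W w' /\ exists k, act g w = act (zpow k) w'.
  have exR g : C g -> exists w', R g w'.
    move=> Cg; have [|k [w' [Ww' e]]] := coverW (x := act g w).
      by apply: MO => //; case: Cg.
    by exists w'; split=> //; exists k.
  apply: (finite_index_map (F := {classic X}) sH finW
    (tau := fun g => xget (y0 : {classic X}) (R g))).
    by move=> g /exR[w' Rw']; case: xgetP => [u _ []//|/(_ w')].
  move=> g h /[dup] Cg /exR[u Ru] /[dup] Ch /exR[v Rv].
  case: xgetP => [u' _ Ru'|/(_ u)//]; case: xgetP => [v' _ Rv'|/(_ v)//] e.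
  move: e Ru' Rv' => <- {v'} [Wu [k gk]] [_ [l hl]].
  split; first by apply: subgroupM => //; apply: subgroupV.
  exists (l - k)%R; rewrite actM; apply: (can_inj (actK g));
    rewrite actVK Czp // gk hl.
  by rewrite -actM -zpowD subrK.
have [|sL fL] := @finite_index_big gT X s (fun w => [set g | C g /\
  strand w (act g w)]) C sC.
  by move=> w /sP' /idx.
have eK : K = [set g | C g /\ forall w, List.In w s ->
  C g /\ strand w (act g w)].
  apply/seteqP; split=> g [Cg gW]; split=> // w; first by move=> /sP' /gW.
  by move=> /sP' /gW[].
by rewrite -eK in sL fL; split=> //; apply: finite_index_trans fL fC.
Qed.

Let shift w (g : gT) : int := xget 0%R [set k | act g w = act (zpow k) w].

Let shiftP w g : K g -> W w -> act g w = act (zpow (shift w g)) w.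
Proof.
by move=> [_ Kg] Ww; rewrite /shift; case: xgetP => // nk;
  have [k /nk] := Kg w Ww.
Qed.

Let shift_additive w : W w -> additive_on K (shift w).
Proof.
move=> Ww g h Kg Kh; have [sK _] := sK_fK.
have e : act (zpow (shift w (g * h))) w = act (zpow (shift w h + shift w g)%R)
  w.
  have Cg : C g by case: Kg.
  rewrite -(shiftP (subgroupM sK Kg Kh) Ww) actM (shiftP Kh Ww).
  by rewrite (Czp _ Cg (WO Ww)) (shiftP Kg Ww) zpowD actM.
by have [-> _] := zpW_inj Ww Ww e; rewrite addrC.
Qed.

Let strandK w : W w -> preserved act K (strand w).
Proof.
move=> Ww g _ Kg [k ->]; rewrite Czp; [|by case: Kg|exact: WO].
by exists (k + shift w g)%R; rewrite zpowD actM -shiftP.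
Qed.

(** In the coordinate [k] the strand is a line, [B] a half-line and [g] a translation, so the
    displacement is an interval. *)
Let nu_strand w g : W w -> K g -> nu act (B `&` strand w) g = `|shift w g|%N.
Proof.
move=> Ww Kg; have [sK _] := sK_fK; have KVg := subgroupV sK Kg.
have -> : `|shift w g|%N = `|shift w g^-1|%N.
  have e0 : shift w 1 = 0%R.
    by have := shift_additive Ww (subgroup1 sK) (subgroup1 sK); rewrite mulg1;
      lia.
  by have := shift_additive Ww Kg KVg; rewrite mulgV e0; lia.
rewrite /nu displacementE // (moved_setI act1 actM _ sK (strandK Ww) KVg).
set d := shift w g^-1.
have B_k k : B (act (zpow k) w) <-> (0 <= k)%R := B_W k Ww.
have gk k : act g^-1 (act (zpow k) w) = act (zpow (k + d)%R) w.
  rewrite Czp; [|by case: KVg|exact: WO].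
  by rewrite zpowD actM -shiftP.
(* The left end of the interval of those [k] for which [0 <= k] and [0 <= k + d] disagree. *)
pose c : int := if (0 <= d)%R then (- d)%R else 0%R.
have -> : moved act B g^-1 `&` strand w = (fun n :
  nat => act (zpow (c + n%:Z)%R) w) @` `I_(`|d|%N).
  apply/seteqP; split=> x.
    move=> [+ [k ek]]; rewrite ek /moved /= gk !B_k => mk.
    exists (`|k - c|%N); first by rewrite /= /c; case: ifP => d0; lia.
    congr (act (zpow _) w); rewrite /c in mk *; case: ifP => d0; lia.
  move=> [n /= ltn <-]; split; last by exists (c + n%:Z)%R.
  by rewrite /moved /= gk !B_k /c; case: ifP => d0; lia.
rewrite ncard_image_inj; first by apply: ncard_eq.
- exact: finite_II.
- by move=> n m _ _ /(zpW_inj Ww Ww)[e _]; lia.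
Qed.

Lemma strip_virtual_sum : finite_index M setT -> virtual_sum (nu act B).
Proof.
move=> fM; have [sK fK] := sK_fK.
have fKT : finite_index K setT by apply: finite_index_trans fK fM.
have [s sP'] := finite_set_seq finW.
have KM : K `<=` M by move=> g [[]].
have inS U : List.In U (map strand s) -> exists2 w, W w & U = strand w.
  by move=> /List.in_map_iff[w [<- /sP' Ww]]; exists w.
apply: (@virtual_sum_pieces _ _ act K (map strand s)) => //.
- by move=> U /inS[w Ww ->]; apply: strandK.
- move=> U U' /inS[w Ww ->] /inS[w' Ww' ->].
  have [<-|nw] := pselect (w = w'); [by left | right].
  apply/seteqP; split=> // x [[k ->] [l e]]; apply: nw.
  by have [] := zpW_inj Ww Ww' e.
- exact: commensurated_sub cB.
- move=> x /BO /coverW[k [w [Ww ->]]]; exists (strand w); last by exists k.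
  by apply/List.in_map_iff; exists w; split=> //; apply/sP'.
- move=> U /inS[w Ww ->]; exists K, [:: shift w], 0%N; split=> //.
    by move=> phi [<-|//]; apply: shift_additive.
  by move=> g Kg; rewrite nu_strand // /sum_abs big_seq1 !addn0.
Qed.

End Strip.

Lemma two_ended_virtual_sum B : finite_index M setT ->
  commensurated M act B -> B `<=` O -> infinite_set B ->
    infinite_set (O `\` B) ->
  virtual_sum (nu act B).
Proof.
move=> fM cB BO infB infCB.
have [z Qz [zB [u Ou [Bu nBu]]]] := shifting_element cB BO infB infCB.
have QVz := subgroupV sQ Qz.
have finb : finite_set (bd act S B `&` O).
  apply: finite_setIl; apply: (finite_bd act1 actM (M := M)) => // s /SP;
    exact: PM.
have [v [Ov nBv]] := infinite_setN0 infCB.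
apply: (strip_virtual_sum Qz cB BO zB) => //.
  apply: (escapes QVz finb zB); first by exists u.
  by exists v.
move=> x Ox.
(* [escapes] is used a second time, for [z] and the complement of [B], to see that powers of [z]
   bring every point into [B]. *)
have finb' : finite_set (bd act S (~` B) `&` O).
  apply: sub_finite_set finb => y [[s Ss mB] Oy]; split=> //.
  by exists s => //; rewrite -moved_setC.
have [|||n /contrapT] := escapes (B := ~` B) Qz finb' _ _ _ Ox;
  last by exists n.
- move=> y Oy nBzy By; apply: nBzy; apply: zB; first exact: QO.
  by rewrite actK.
- exists (act z^-1 u); first exact: QO.
  by split=> //; rewrite actVK => /(_ Bu).
- by exists u => //; apply.
Qed.

End TwoEnded.

(** * Subgroups as groups, vertices and rays *)

Section SubgroupType.
Local Open Scope classical_set_scope.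
Local Open Scope group_scope.
Variables (gT : groupType) (G : set gT).

(** The sections above assume the action laws for all group elements, while an action of [G] obeys
    them on [G] only, so [G] becomes a group of its own. The subgroup proof is a parameter so that
    the group structure can be inferred from the type. *)
Definition subgroup_type of is_subgroup G : Type := {g : gT | g \in G}.

Variable sG : is_subgroup G.
Notation Gt := (subgroup_type sG).

HB.instance Definition _ := Choice.copy Gt {g : gT | g \in G}.

Definition of_mem g (Gg : G g) : Gt := exist _ g (mem_set Gg).

Lemma subgroup_typeP (g : Gt) : G (val g).
Proof. exact: set_mem (valP g). Qed.

Definition sub_mul (g h : Gt) : Gt :=
  of_mem (subgroupM sG (subgroup_typeP g) (subgroup_typeP h)).
Definition sub_one : Gt := of_mem (subgroup1 sG).
Definition sub_inv (g : Gt) : Gt := of_mem (subgroupV sG (subgroup_typeP g)).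

Lemma sub_mulA : associative sub_mul.
Proof. by move=> g h k; apply: val_inj; rewrite /= mulgA. Qed.
Lemma sub_mul1g : left_id sub_one sub_mul.
Proof. by move=> g; apply: val_inj; rewrite /= mul1g. Qed.
Lemma sub_mulg1 : right_id sub_one sub_mul.
Proof. by move=> g; apply: val_inj; rewrite /= mulg1. Qed.
Lemma sub_mulVg : left_inverse sub_one sub_inv sub_mul.
Proof. by move=> g; apply: val_inj; rewrite /= mulVg. Qed.
Lemma sub_mulgV : right_inverse sub_one sub_inv sub_mul.
Proof. by move=> g; apply: val_inj; rewrite /= mulgV. Qed.

HB.instance Definition _ :=
  isGroup.Build Gt sub_mulA sub_mul1g sub_mulg1 sub_mulVg sub_mulgV.

Lemma val_mul (g h : Gt) : val (g * h) = val g * val h. Proof. by []. Qed.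
Lemma val_inv (g : Gt) : val g^-1 = (val g)^-1. Proof. by []. Qed.

Lemma subgroup_preimage (H : set gT) :
  is_subgroup H -> is_subgroup [set g : Gt | H (val g)].
Proof.
move=> sH; apply/is_subgroupP; split=> [|g h Hg Hh|g Hg].
- exact: (subgroup1 sH).
- exact: (subgroupM sH).
- exact: (subgroupV sH).
Qed.

Lemma generated_preimage (S : set gT) (g : Gt) : S `<=` G ->
  generated S (val g) -> generated [set h : Gt | S (val h)] g.
Proof.
move=> SG; pose L := [set h | exists2 g : Gt, val g = h & generated [set h :
  Gt | S (val h)] g].
have sS := @subgroup_generated _ [set h : Gt | S (val h)].
have sL : is_subgroup L.
  apply/is_subgroupP; split.
  - by exists 1 => //; apply: subgroup1.
  - move=> _ _ [a <- Sa] [b <- Sb]; exists (a * b) => //; exact: (subgroupM sS).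
  - move=> _ [a <- Sa]; exists a^-1 => //; exact: (subgroupV sS).
move=> Sg; have [h /val_inj <- //] : L (val g).
apply: generated_ind Sg => // s Ss; exists (of_mem (SG _ Ss)) => //.
by apply: sub_generated.
Qed.

Lemma finite_preimage_val (S : set gT) :
  finite_set S -> finite_set [set h : Gt | S (val h)].
Proof.
move=> finS; apply: (@finite_preimage _ _ S val) finS => g h _ _;
  exact: val_inj.
Qed.

Lemma finitely_generated_subgroup_type :
  finitely_generated G -> finitely_generated [set: Gt].
Proof.
move=> [S finS genS]; exists [set h : Gt | S (val h)];
  first exact: finite_preimage_val.
apply/seteqP; split=> // g _; apply: generated_preimage.
  by rewrite -genS; apply: sub_generated.
by rewrite genS; apply: subgroup_typeP.
Qed.

Lemma finite_index_preimage (H K : set gT) : is_subgroup H -> K `<=` G ->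
  finite_index H K -> finite_index [set g : Gt | H (val g)] [set g :
    Gt | K (val g)].
Proof.
move=> sH KG /(finite_index_rep sH)[r [finr rK rE]].
apply: (finite_index_map (subgroup_preimage sH) finr (tau :=
  fun g : Gt => r (val g))).
  by move=> g Kg; exists (val g).
move=> g h Kg Kh e; have [_ Hg] := rK _ Kg; have [_] := rK _ Kh;
  rewrite -e => Hh.
have := subgroupM sH (subgroupV sH Hg) Hh.
by rewrite invgM invgK !mulgA mulgK.
Qed.

End SubgroupType.

Section Vertices.
Local Open Scope classical_set_scope.
Local Open Scope group_scope.
Variable T : rooted_tree.
Implicit Types (u v w : T).

Lemma level_iter_parent k u : level (iter k (@parent T) u) = (level u - k)%N.
Proof.
by elim: k => [|k IHk] /=; [rewrite subn0 | rewrite level_parent IHk subnS].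
Qed.

(** [parent] is constant from the root on, so a witness exceeding the level of [u] can be cut down
    to the difference of levels. *)
Lemma subtree_ancestor v u :
  subtree v u -> v = iter (level u - level v) (@parent T) u.
Proof.
move=> [k <-]; rewrite level_iter_parent.
have [lek|ltk] := leqP k (level u); first by rewrite subKn.
have -> : (level u - k = 0)%N by lia.
rewrite subn0 -(subnK (ltnW ltk)) iterD.
have /level_eq0 -> : level (iter (level u) (@parent T) u) = 0%N.
  by rewrite level_iter_parent subnn.
by elim: (k - level u)%N => //= m ->; rewrite parent_root.
Qed.

Lemma subtree_eq v w u :
  level v = level w -> subtree v u -> subtree w u -> v = w.
Proof. by move=> e /subtree_ancestor -> /subtree_ancestor ->; rewrite e. Qed.

Lemma subtree_refl v : subtree v v. Proof. by exists 0%N. Qed.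

Lemma subtree_parent v u : subtree v u -> subtree (parent v) u.
Proof. by move=> [k <-]; exists k.+1. Qed.

Lemma subtree_aut (g : tree_aut T) v u : subtree v u -> subtree (g v) (g u).
Proof.
move=> [k <-]; exists k; elim: k => //= k ->; by rewrite aut_parent.
Qed.

Lemma finite_level n : locally_finite T -> finite_set [set v : T | level v = n].
Proof.
move=> lfT; elim: n => [|n IHn].
  by apply: sub_finite_set (finite_set1 (Defs.root T)) => v /level_eq0.
apply: (@sub_finite_set _ _ (\bigcup_(v in [set v :
  T | level v = n]) children v)).
  move=> v /= lv; exists (parent v); first by rewrite /= level_parent lv.
  by split=> // ev; move: lv; rewrite (level_eq0 v).2.
by apply: bigcup_finite => // v _; apply: lfT.
Qed.

Lemma ray_ext (xi eta : ray T) : (forall n, xi n = eta n) -> xi = eta.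
Proof.
case: xi eta => [a la pa] [b lb pb] /= /funext eab.
by case: _ / eab in lb pb *; congr Ray; apply: Prop_irrelevance.
Qed.

Lemma ray_ancestor (xi : ray T) n m : iter m (@parent T) (xi (m + n)%N) = xi n.
Proof. by elim: m => //= m IHm; rewrite -iterS iterSr ray_parent. Qed.

Lemma ray_subtree (xi : ray T) n m : (n <= m)%N -> subtree (xi n) (xi m).
Proof. by move=> /subnK <-; exists (m - n)%N; apply: ray_ancestor. Qed.

End Vertices.

(** * Rigid stabilizers and fixators *)

Section RigidStabilizers.
Local Open Scope classical_set_scope.
Local Open Scope group_scope.
Variables (T : rooted_tree) (G : set (tree_aut T)) (sG : is_subgroup G).
Notation Gt := (subgroup_type sG).
Implicit Types (g h : Gt) (u v w : T).

Definition tact g v : T := aut_fun (val g) v.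

Lemma tact1 v : tact 1 v = v. Proof. by []. Qed.
Lemma tactM g h v : tact (g * h) v = tact g (tact h v). Proof. by []. Qed.
Lemma tactK g : cancel (tact g) (tact g^-1).
Proof. by move=> v; rewrite -tactM mulVg. Qed.
Lemma tactVK g : cancel (tact g^-1) (tact g).
Proof. by move=> v; rewrite -tactM mulgV. Qed.

Lemma tact_inj g h : (forall v, tact g v = tact h v) -> g = h.
Proof. by move=> e; apply: val_inj; apply: tree_autP. Qed.

Lemma level_tact g v : level (tact g v) = level v. Proof. exact: aut_level. Qed.

Lemma subtree_tact g v w : subtree (tact g v) (tact g w) <-> subtree v w.
Proof.
split=> [|]; last exact: subtree_aut.
by move=> /(subtree_aut (val g^-1)); rewrite -!/(tact _ _) !tactK.
Qed.

Definition rigid v : set Gt :=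
  [set g | forall w, ~ subtree v w -> tact g w = w].

Definition fixator v : set Gt :=
  [set g | forall w, subtree v w -> tact g w = w].

Definition rigid_level n : set Gt :=
  generated (\bigcup_(v in [set v | level v = n]) rigid v).

Lemma subgroup_rigid v : is_subgroup (rigid v).
Proof.
apply/is_subgroupP; split=> // [g h gv hv w nw|g gv w nw].
  by rewrite tactM hv ?gv.
by apply: (can_inj (tactK g)); rewrite tactVK gv.
Qed.

Lemma subgroup_fixator v : is_subgroup (fixator v).
Proof.
apply/is_subgroupP; split=> // [g h gv hv w nw|g gv w nw].
  by rewrite tactM hv ?gv.
by apply: (can_inj (tactK g)); rewrite tactVK gv.
Qed.

(** The supports are complementary, and both elements preserve the subtree at [v] and its
    complement. *)
Lemma rigid_fixatorC v g h : rigid v g -> fixator v h -> g * h = h * g.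
Proof.
move=> gv hv; apply: tact_inj => w; rewrite !tactM.
have [vw|nvw] := pselect (subtree v w).
  rewrite hv // hv //; apply: contrapT => nvgw; apply: (nvgw).
  by have := gv _ nvgw; move=> /(can_inj (tactK g)) ->.
rewrite (gv w nvw) gv // => vhw; apply: nvw.
by have := hv _ vhw; move=> /(can_inj (tactK h)) <-.
Qed.

Lemma rigid_fixatorI v g : rigid v g -> fixator v g -> g = 1.
Proof.
move=> gv gv'; apply: tact_inj => w; rewrite tact1.
by have [/gv'|/gv] := pselect (subtree v w).
Qed.

Lemma rigid_sub_fixator v w :
  level v = level w -> v <> w -> rigid w `<=` fixator v.
Proof.
by move=> e nvw g gw u vu; apply: gw => wu; apply/nvw/(subtree_eq e vu).
Qed.

Lemma fixator_parent v : fixator (parent v) `<=` fixator v.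
Proof. by move=> g gv w /subtree_parent; apply: gv. Qed.

Lemma fixator_subtree v w : subtree v w -> fixator v `<=` fixator w.
Proof.
move=> [k <-]; elim: k => [//|k IHk] g gv; apply: IHk => //=.
exact: fixator_parent.
Qed.

Lemma fixator_conj g h v : fixator v h -> fixator (tact g v) (g * h * g^-1).
Proof.
move=> hv w; rewrite -{1}(tactVK g w) subtree_tact => /hv e.
by rewrite !tactM e tactVK.
Qed.

Lemma rigid_sub_level v : rigid v `<=` rigid_level (level v).
Proof. by move=> g gv; apply: sub_generated; exists v. Qed.

(** The rigid stabilizer of another vertex at this level fixes the subtree at [v]. Through this the
    branch condition gives a finite-index product of two commuting subgroups. *)
Lemma rigid_level_sub v : rigid_level (level v) `<=` setprod (rigid v) (fixator
  v).
Proof.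
have sv := subgroup_setprod (subgroup_rigid v) (subgroup_fixator v)
  (@rigid_fixatorC v).
move=> g; apply: generated_ind => // h [w /= e wh].
have [vw|nvw] := pselect (v = w).
  by apply: (sub_setprodl (subgroup_fixator v)); rewrite vw.
apply: (sub_setprodr (subgroup_rigid v));
  exact: (rigid_sub_fixator (esym e) nvw).
Qed.

Hypothesis lfT : locally_finite T.
Hypothesis fgG : finitely_generated [set: Gt].
Hypothesis rigid_index : forall n, finite_index (rigid_level n) [set: Gt].

Lemma finite_index_rigid_fixator v :
  finite_index (setprod (rigid v) (fixator v)) [set: Gt].
Proof.
have sv := subgroup_setprod (subgroup_rigid v) (subgroup_fixator v)
  (@rigid_fixatorC v).
apply: finite_index_super (rigid_index (level v)) => //;
  first exact: subgroup_generated.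
exact: rigid_level_sub.
Qed.

Lemma finitely_generated_rigid v : finitely_generated (rigid v).
Proof.
have sv := subgroup_setprod (subgroup_rigid v) (subgroup_fixator v)
  (@rigid_fixatorC v).
apply: (finitely_generated_setprodl (subgroup_rigid v) (subgroup_fixator v)).
- exact: rigid_fixatorC.
- exact: rigid_fixatorI.
- apply: finitely_generated_finite_index fgG => //; first exact: subgroupT.
  exact: finite_index_rigid_fixator.
Qed.

Lemma finitely_generated_fixator v : finitely_generated (fixator v).
Proof.
have sv := subgroup_setprod (subgroup_rigid v) (subgroup_fixator v)
  (@rigid_fixatorC v).
apply: (finitely_generated_setprodl (subgroup_fixator v) (subgroup_rigid v)).
- by move=> g h gv hv; rewrite (rigid_fixatorC hv gv).
- by move=> g gv gv'; apply: (rigid_fixatorI gv').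
- have -> : setprod (fixator v) (rigid v) = setprod (rigid v) (fixator v).
    by apply/seteqP; split=> _ [a [b [aR bK ->]]]; exists b, a; split=> //;
      [rewrite (rigid_fixatorC bK aR) | rewrite (rigid_fixatorC aR bK)].
  apply: finitely_generated_finite_index fgG => //; first exact: subgroupT.
  exact: finite_index_rigid_fixator.
Qed.

(** * Orbits of rigid stabilizers and fixators in an arbitrary action *)

Section Orbits.
Variables (X : Type) (act : Gt -> X -> X).
Hypotheses (act1 : forall x, act 1 x = x)
  (actM : forall g h x, act (g * h) x = act g (act h x)).
Implicit Types (x y : X) (A : set X).

(** Rigid stabilizers of distinct vertices at one level commute and there are finitely many, so the
    orbit is that of a finite product; the induction runs over a list of these vertices. *)
Lemma finite_orb_rigid_level n x :
  (forall v, level v = n -> finite_set (orb act (rigid v) x)) ->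
  finite_set (orb act (rigid_level n) x).
Proof.
move=> finx; have [s sP] := finite_set_seq (finite_level n lfT).
pose K (s : seq T) := generated (\bigcup_(v in [set v | List.In v s]) rigid v).
have -> : rigid_level n = K s.
  by rewrite /rigid_level /K; congr generated; apply: eq_bigcupl; split=> v;
    [move=> /sP | move=> ?; apply/sP].
have : forall v, List.In v s -> level v = n by move=> v /sP.
elim: s {sP} => [|v s IHs] sn.
  apply: (@sub_finite_set _ _ [set x]); last exact: finite_set1.
  move=> _ [g Kg <-]; rewrite (_ : g = 1) ?act1 //.
  apply: (@generated_ind _ _ [set 1] g _ _ Kg); last by move=> h [].
  by apply/is_subgroupP; split=> // [? ? -> ->|? ->]; rewrite ?mulg1 ?invg1.
have finK : finite_set (orb act (K s) x) by apply: IHs => w sw; apply: sn;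
  right.
have [vs|nvs] := pselect (List.In v s).
  have -> // : K (v :: s) = K s.
  by rewrite /K; congr generated; apply: eq_bigcupl; split=> w;
    [case=> [<-|]|right].
have sK : is_subgroup (K s) by exact: subgroup_generated.
have KR : K s `<=` fixator v.
  move=> g; apply: generated_ind; first exact: subgroup_fixator.
  move=> h [w sw wh]; apply: (rigid_sub_fixator _ _ wh).
    by rewrite !sn //; [right | left].
  by move=> e; apply: nvs; rewrite e.
have Kcomm a b : rigid v a -> K s b -> a * b = b * a.
  by move=> va /KR; apply: rigid_fixatorC.
apply: sub_finite_set (finite_orb_setprod actM (subgroup_rigid v) Kcomm (finx v
  _) finK); last first.
  by apply: sn; left.
apply: sub_orb => g; apply: generated_ind.
  exact: (subgroup_setprod (subgroup_rigid v)).
move=> h [w [<-|sw] wh]; first exact: (sub_setprodl sK).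
by apply: (sub_setprodr (subgroup_rigid v)); apply: sub_generated; exists w.
Qed.

Lemma finite_index_setprodr (P Q Q0 : set Gt) :
  is_subgroup P -> is_subgroup Q0 -> Q0 `<=` Q ->
  (forall p q, P p -> Q q -> p * q = q * p) ->
  finite_index Q0 Q -> finite_index (setprod P Q0) (setprod P Q).
Proof.
move=> sP sQ0 Q0Q PQ /(finite_index_rep sQ0)[r [finr rQ rE]].
have sPQ0 : is_subgroup (setprod P Q0).
  by apply: subgroup_setprod => // p q Pp /Q0Q; apply: PQ.
pose part g := xget 1 [set q | Q q /\ exists2 p, P p & g = p * q].
have partP g : setprod P Q g -> Q (part g) /\ exists2 p, P p & g = p * part g.
  move=> [p [q [Pp Qq eg]]]; rewrite /part; case: xgetP => // /(_ q)[].
  by split=> //; exists p.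
apply: (finite_index_map sPQ0 finr (tau := fun g => r (part g))).
  by move=> g /partP[Qg _]; exists (part g).
move=> g h /partP[Qg [p Pp eg]] /partP[Qh [p' Pp' eh]] e.
have [_ Hg] := rQ _ Qg; have [_] := rQ _ Qh; rewrite -e => Hh.
have Qgh : Q0 ((part g)^-1 * part h).
  by have := subgroupM sQ0 (subgroupV sQ0 Hg) Hh;
    rewrite invgM invgK !mulgA mulgK.
have Pr : P (p^-1 * p') by apply: subgroupM => //; apply: subgroupV.
exists (p^-1 * p'), ((part g)^-1 * part h); split=> //.
rewrite (PQ (p^-1 * p')) //; last exact: Q0Q.
have -> : g^-1 * h = (p * part g)^-1 * (p' * part h) by rewrite -eg -eh.
by rewrite invgM -!mulgA; congr (_ * _); rewrite mulgA PQ.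
Qed.

(** Once finite and cofinite pieces are set aside, some rigid stabilizer [P] has an infinite orbit
    at [x]. Then [few_orbits] leaves finitely many [P]-orbits, a finite-index subgroup [Q0] of the
    fixator preserves each, and [two_ended_virtual_sum] treats them one by one. *)
Lemma virtual_sum_rigid_piece n x A : commensurated setT act A ->
  (forall v y, level v = n -> orb act setT x y ->
     infinite_set (orb act (fixator v) y)) ->
  virtual_sum (nu act (A `&` orb act (rigid_level n) x)).
Proof.
move=> cA infR; set O := orb act _ x.
have sL : is_subgroup (rigid_level n) by exact: subgroup_generated.
have LO : preserved act (rigid_level n) O by exact: preserved_orb.
have fL := rigid_index n.
have Ox : O x by exact: orb_refl.
have [finA|infA] := pselect (finite_set (A `&` O)).
  by apply: (virtual_sum_bounded sL fL) => g _; apply: (nu_finite act1 actM).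
have [finC|infC] := pselect (finite_set (O `\` (A `&` O))).
  apply: (virtual_sum_bounded sL fL) => g Lg.
  by apply: (nu_cofinite act1 actM sL LO) finC => // ? [].
have [v lv infv] : exists2 v, level v = n & infinite_set (orb act (rigid v) x).
  apply: contrapT => nv.
  have finO : finite_set O.
    apply: finite_orb_rigid_level => v lv; apply: contrapT => infv.
    by apply: nv; exists v.
  by apply: infA; apply: finite_setIr.
pose P := rigid v; pose Q := fixator v.
have sP : is_subgroup P by exact: subgroup_rigid.
have sQ : is_subgroup Q by exact: subgroup_fixator.
have PQ := @rigid_fixatorC v.
have sPQ : is_subgroup (setprod P Q) by exact: subgroup_setprod.
have LPQ : rigid_level n `<=` setprod P Q by rewrite -lv;
  apply: rigid_level_sub.
have PL : P `<=` rigid_level n by rewrite -lv; apply: rigid_sub_level.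
have [S finS genS] := finitely_generated_rigid v.
pose Y := orb act (setprod P Q) x.
have OY : O `<=` Y by exact: sub_orb.
have cAPQ : commensurated (setprod P Q) act A by exact: commensurated_sub cA.
have [||D finD [DY covD]] := few_orbits act1 actM sP sQ PQ finS genS infv cAPQ.
- by apply: contra_not infA; apply: sub_finite_set => y [Ay Oy]; split=> //;
  apply: OY.
- apply: contra_not infC; apply: sub_finite_set => y [Oy nAy]; split;
  first exact: OY.
  by move=> Ay; apply: nAy.
have [s sD] := finite_set_seq finD.
(* [Q] commutes with [P] and so permutes the finitely many [P]-orbits in [Y]; this is the stabilizer
   of the orbit of [d]. *)
pose H d := [set q | Q q /\ orb act P d (act q d)].
have HP d : D d -> is_subgroup (H d) /\ finite_index (H d) Q.
  move=> Dd; have sH : is_subgroup (H d).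
    apply/is_subgroupP; split.
    - by split; [apply: (subgroup1 sQ) | rewrite act1; apply: (orb_refl act1)].
    - move=> a b [Qa [p Pp pa]] [Qb [p' Pp' pb]]; split;
      first exact: (subgroupM sQ).
      exists (p' * p); first exact: (subgroupM sP).
      by rewrite !actM -pb pa -!actM (PQ p' a).
    - move=> a [Qa [p Pp pa]]; have QVa := subgroupV sQ Qa; split=> //.
      exists p^-1; first exact: (subgroupV sP).
      apply: (can_inj (actK act1 actM p)).
      by rewrite actVK // -actM PQ // actM pa actK.
  split=> //.
  have cov q : Q q -> exists2 z, D z & orb act P z (act q d).
    move=> Qq; apply: covD; apply: (preserved_orb actM sPQ); last exact: DY.
    exact: (sub_setprodr sP).
  apply: (finite_index_map (F := {classic X}) sH finD
    (tau := fun q => xget (x : {classic X}) [set z | D z /\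
      orb act P z (act q d)])).
    move=> q /cov[z Dz zq]; case: xgetP => [u _ []//|/(_ z)[]//].
  move=> q q' /[dup] Qq /cov[z Dz zq] /[dup] Qq' /cov[z' Dz' zq'].
  case: xgetP => [u _ [Du uq]|/(_ z)[]//];
    case: xgetP => [u' _ [Du' uq']|/(_ z')[]//] e.
  move: e uq' => <- uq'; have QVq := subgroupV sQ Qq.
  split; first exact: (subgroupM sQ).
  have : orb act P (act q d) (act q' d) by rewrite (orb_eq act1 actM sP uq).
  move=> [p Pp e]; exists p => //.
  by rewrite actM -e -!actM -mulgA (PQ p q) // mulKg.
have [|sQ0 fQ0] := @finite_index_big _ _ s H Q sQ; first by move=> d /sD /HP.
set Q0 := [set g | _] in sQ0 fQ0.
have Q0Q : Q0 `<=` Q by move=> q [].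
have PQ0 p q : P p -> Q0 q -> p * q = q * p by move=> Pp /Q0Q; apply: PQ.
pose M := setprod P Q0.
have sM : is_subgroup M by exact: subgroup_setprod.
have fM : finite_index M setT.
  apply: finite_index_trans (finite_index_rigid_fixator v) => //.
  exact: finite_index_setprodr.
have Q0orb d q : D d -> Q0 q -> preserved act [set q] (orb act P d).
  move=> Dd [Qq Hq] _ _ -> [p Pp <-].
  have [_ [p' Pp' e]] := Hq d ((sD d).1 Dd).
  exists (p * p'); first exact: (subgroupM sP).
  by rewrite actM e -!actM PQ.
have Morb d : D d -> preserved act M (orb act P d).
  move=> Dd _ y [p [q [Pp Q0q ->]]] dy; rewrite actM.
  by apply: (preserved_orb actM sP) => //; apply: (Q0orb d q).
(* [M] need not lie in [rigid_level n], but it keeps each point in its [P]-orbit, and [P] does lie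
   there. *)
have MO : preserved act M O.
  move=> m y Mm Oy; have [d Dd dy] := covD y (OY _ Oy).
  have [p Pp <-] : orb act P y (act m y).
    by rewrite (orb_eq act1 actM sP dy); apply: Morb.
  by apply: LO => //; apply: PL.
have cM : commensurated M act (A `&` O).
  by apply: (commensurated_setI act1 actM) => //; apply: commensurated_sub cA.
have inS U : List.In U (map (orb act P) s) -> exists2 d, D d & U = orb act P d.
  by move=> /List.in_map_iff[d [<- /sD Dd]]; exists d.
apply: (@virtual_sum_pieces _ _ act M (map (orb act P) s)) => //.
- by move=> U /inS[d Dd ->]; apply: Morb.
- by move=> U U' /inS[d Dd ->] /inS[d' Dd' ->]; apply: orb_disjoint.
- move=> y [Ay /OY /covD[d Dd dy]]; exists (orb act P d) => //.
  by apply/List.in_map_iff; exists d; split=> //; apply/sD.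
- move=> U /inS[d Dd ->]; set B := A `&` O `&` _.
  have cB : commensurated M act B by apply: (commensurated_setI act1 actM) =>
    //; apply: Morb.
  have Bd : B `<=` orb act P d by move=> ? [].
  have [finB|infB] := pselect (finite_set B).
    by apply: (virtual_sum_bounded sM fM) => g _; apply: (nu_finite act1 actM).
  have [finCB|infCB] := pselect (finite_set (orb act P d `\` B)).
    apply: (virtual_sum_bounded sM fM) => g Mg.
    by apply: (nu_cofinite act1 actM sM (Morb d Dd)) finCB.
  apply: (two_ended_virtual_sum act1 actM sP sQ0 PQ0 finS genS (y0 := d)) => //.
    by move=> q y Q0q; apply: (Q0orb d q).
  move=> finQ0; apply: (infR v d lv).
    by have := DY d Dd; apply: sub_orb.
  exact: (finite_orb_index actM sQ0 fQ0 finQ0).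
Qed.

Lemma virtual_sum_infinite_fixator_orbits n x A : commensurated setT act A ->
  A `<=` orb act setT x ->
  (forall v y, level v = n -> orb act setT x y ->
     infinite_set (orb act (fixator v) y)) ->
  virtual_sum (nu act A).
Proof.
move=> cA Ax infR.
have sL : is_subgroup (rigid_level n) by exact: subgroup_generated.
have [r [finr rL _]] := finite_index_rep sL (rigid_index n).
(* [r] represents left cosets, while the orbits of [rigid_level n] come from right cosets; hence the
   inverses. *)
pose F := (fun c => act c^-1 x) @` (r @` setT).
have [s sF] := finite_set_seq (finite_image (fun c => act c^-1 x) finr).
have inS U : List.In U (map (orb act (rigid_level n)) s) ->
    exists2 c, F (act c^-1 x) & U = orb act (rigid_level n) (act c^-1 x).
  move=> /List.in_map_iff[y [<- /sF Fy]]; case: (Fy) => c _ e.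
  by exists c; rewrite e.
apply: (@virtual_sum_pieces _ _ act _ (map (orb act (rigid_level n)) s))
  (rigid_index n) _ _ _ _ _ => //.
- by move=> U /inS[c _ ->]; apply: preserved_orb.
- by move=> U U' /inS[c _ ->] /inS[c' _ ->]; apply: orb_disjoint.
- exact: commensurated_sub cA.
- move=> y /Ax[g _ <-]; exists (orb act (rigid_level n) (act (r g^-1)^-1 x)).
    apply/List.in_map_iff; exists (act (r g^-1)^-1 x); split=> //.
    by apply/sF; exists (r g^-1) => //; exists g^-1.
  have [_ /(subgroupV sL)] := rL g^-1 I; rewrite invgM !invgK => Lg.
  by exists (g * r g^-1) => //; rewrite -actM mulgK.
- move=> U /inS[c _ ->]; apply: virtual_sum_rigid_piece => // v y lv cy.
  apply: infR => //; case: cy => g _ <-; rewrite -actM; exists (g * c^-1) => //.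
Qed.

End Orbits.
End RigidStabilizers.

(** * Classes of a germ stabilizer *)

Section Bounds.
Local Open Scope classical_set_scope.

Lemma finite_set_bounded (X : Type) (F : set X) (Q : X -> nat -> Prop) :
  finite_set F -> (forall x m n, (m <= n)%N -> Q x m -> Q x n) ->
  (forall x, F x -> exists n, Q x n) -> exists n, forall x, F x -> Q x n.
Proof.
move=> finF monoQ; move: F finF; apply: finite_set_ind => [_|x F finF _ IH QF].
  by exists 0%N.
have [|n nF] := IH; first by move=> y Fy; apply: QF; right.
have [m mx] := QF x (or_introl erefl).
exists (maxn m n) => y [->|Fy]; first exact: monoQ (leq_maxl _ _) mx.
exact: monoQ (leq_maxr _ _) (nF y Fy).
Qed.

End Bounds.

Section GermRay.
Local Open Scope classical_set_scope.
Local Open Scope group_scope.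
Variables (T : rooted_tree) (G : set (tree_aut T)) (sG : is_subgroup G).
Notation Gt := (subgroup_type sG).
Notation tact := (@tact T G sG).
Notation fixator := (@fixator T G sG).
Notation rigid := (@rigid T G sG).
Notation rigid_level := (@rigid_level T G sG).
Hypothesis lfT : locally_finite T.
Hypothesis fgG : finitely_generated [set: Gt].
Hypothesis rigid_index : forall n, finite_index (rigid_level n) [set: Gt].
Hypothesis transT : forall v w : T, level v = level w -> exists g, tact g v = w.
Implicit Types (g h r : Gt) (u v w : T).

Lemma ray_fix_le (xi : ray T) g k n : (k <= n)%N ->
  tact g (xi n) = xi n -> tact g (xi k) = xi k.
Proof.
move=> lekn e.
have par m v : tact g (iter m (@parent T) v) = iter m (@parent T) (tact g v).
  by elim: m => //= m <-; apply: aut_parent.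
by rewrite -(ray_ancestor xi k (n - k)) subnK // par e.
Qed.

Lemma fixator_ray (xi : ray T) n r k : fixator (xi n) r -> tact r (xi k) = xi k.
Proof.
move=> nr; have [lenk|/ltnW lekn] := leqP n k; first exact/nr/ray_subtree.
by apply: (ray_fix_le lekn); apply: nr; apply: subtree_refl.
Qed.

Lemma fixator_ray_le (xi : ray T) n m :
  (n <= m)%N -> fixator (xi n) `<=` fixator (xi m).
Proof. by move=> lenm; apply: fixator_subtree; apply: ray_subtree. Qed.

(** By level transitivity every vertex below [xi n] lies on a translate of [xi], so fixing the rays
    of a cylinder amounts to fixing the vertices of a subtree. *)
Lemma germ_stabE (xi : ray T) g :
  germ_stab G xi (val g) <-> exists n, fixator (xi n) g.
Proof.
split=> [[Gg [U [n nU] fixU]]|[n gn]].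
  exists n => w nw; have [h hw] := transT (etrans (ray_level xi (level w))
    erefl).
  pose eta := ray_act (val h) xi.
  have eta_w : eta (level w) = w by exact: hw.
  have lenw : (n <= level w)%N.
    by case: nw => k /(congr1 (@level T)); rewrite level_iter_parent ray_level;
      lia.
  have /fixU : U eta.
    have e := ray_ancestor eta n (level w - n); rewrite subnK // eta_w in e.
    apply: nU; apply: (etrans (esym e)).
    by rewrite [RHS](subtree_ancestor nw) ray_level.
  by move=> /(congr1 (fun z : ray T => z (level w))) /=;
    rewrite /= -/(tact h _) hw.
split; first exact: subgroup_typeP.
exists (cylinder xi n); first by exists n.
move=> eta eta_n; apply: ray_ext => k.
have eta_fix : fixator (eta n) g by rewrite (eta_n : eta n = xi n).
exact: (fixator_ray _ eta_fix).
Qed.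

Lemma subgroup_germ_stab (xi : ray T) :
  is_subgroup [set g : Gt | exists n, fixator (xi n) g].
Proof.
apply/is_subgroupP; split.
- by exists 0%N.
- move=> g h [n gn] [m hm]; exists (maxn n m).
  apply: (subgroupM (subgroup_fixator sG _)).
    exact: fixator_ray_le (leq_maxl _ _) _ gn.
  exact: fixator_ray_le (leq_maxr _ _) _ hm.
- by move=> g [n gn]; exists n; apply: (subgroupV (subgroup_fixator sG _)).
Qed.

Section SmallFixators.
Variables (X : Type) (act : Gt -> X -> X).
Hypotheses (act1 : forall x, act 1 x = x)
  (actM : forall g h x, act (g * h) x = act g (act h x)).
Variable x0 : X.
Let Y := orb act setT x0.
Hypothesis infY : infinite_set Y.
Hypothesis small_fixator : forall n, exists v,
  level v = n /\ finite_set (orb act (fixator v) x0).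
Implicit Types (x y : X) (A : set X).

(** For [v] and [w] distinct, the rigid stabilizer of [v] lies in the fixator of [w]. Both factors
    of a finite-index product would then have finite orbits at [x0], making [Y] finite. *)
Lemma small_vertex_unique v w : level v = level w ->
  finite_set (orb act (fixator v) x0) -> finite_set (orb act (fixator w) x0) ->
    v = w.
Proof.
move=> e finv finw; apply: contrapT => nvw; apply: infY.
have sR := subgroup_rigid sG v; have sF := subgroup_fixator sG v.
have finR : finite_set (orb act (rigid v) x0).
  apply: sub_finite_set finw; apply: sub_orb.
  by apply: rigid_sub_fixator; [rewrite e | move=> ewv; apply: nvw].
have C := @rigid_fixatorC _ _ sG v.
apply: (finite_orb_index actM _ (finite_index_rigid_fixator rigid_index v)).
  exact: subgroup_setprod.
exact: finite_orb_setprod.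
Qed.

(** The fixator of a parent is smaller, so its orbit is finite too, and uniqueness identifies the
    parent with the vertex chosen one level up. *)
Lemma germ_ray_exists : exists xi : ray T,
  forall n, finite_set (orb act (fixator (xi n)) x0).
Proof.
have /choice[xi xiP] := small_fixator.
have par n : parent (xi n.+1) = xi n.
  have [l1 f1] := xiP n.+1; have [l0 f0] := xiP n.
  apply: small_vertex_unique => //; first by rewrite level_parent l1 l0.
  by apply: sub_finite_set f1; apply: sub_orb; apply: fixator_parent.
by exists (Ray (fun n => (xiP n).1) par) => n; case: (xiP n).
Qed.

Section Ray.
Variable xi : ray T.
Hypothesis finxi : forall n, finite_set (orb act (fixator (xi n)) x0).

(** Conjugation by [h] carries the finite orbit of the fixator of [xi n] to one of the fixator of
    [tact h (xi n)] at the same point. *)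
Lemma point_stab_ray h n : act h x0 = x0 -> tact h (xi n) = xi n.
Proof.
move=> hx; apply: small_vertex_unique; rewrite ?level_tact ?ray_level //.
apply: (finite_orb_conj act1 actM (m := h^-1) (P' := fixator (xi n))).
  by move=> p /(@fixator_conj _ _ _ h^-1 _ _); rewrite tactK.
by rewrite -{1}hx actK.
Qed.

Lemma orb_point_ray g h n :
  act g x0 = act h x0 -> tact g (xi n) = tact h (xi n).
Proof.
move=> e; have -> : h = g * (g^-1 * h) by rewrite mulVKg.
rewrite tactM [in RHS]point_stab_ray //.
by rewrite actM -e actK.
Qed.

(** [y] is in the orbit of [x] under the fixator of [tact g (xi n)], a vertex depending on [x] alone
    by [orb_point_ray]. With [r] on the right of [g], invariance under the action is immediate. *)
Definition rel n x y :=
  exists g r, [/\ fixator (xi n) r, x = act g x0 & y = act (g * r) x0].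
Definition germ_rel x y := exists n, rel n x y.

Lemma rel_refl n x : Y x -> rel n x x.
Proof.
move=> [g _ <-]; exists g, 1; split=> //; last by rewrite mulg1.
Qed.

Lemma rel_sym n x y : rel n x y -> rel n y x.
Proof.
move=> [g [r [nr -> ->]]]; exists (g * r), r^-1; split=> //;
  last by rewrite mulgK.
exact: (subgroupV (subgroup_fixator sG _)).
Qed.

Lemma rel_trans n x y z : rel n x y -> rel n y z -> rel n x z.
Proof.
move=> [g [r [nr ex ey]]] [g' [r' [nr' ey' ez]]].
(* [h] fixes [x0], hence [xi n], so conjugation by [h] preserves the fixator of [xi n]. *)
pose h := (g * r)^-1 * g'.
have hx : act h x0 = x0 by rewrite actM -ey' ey actK.
have eg' : g' = g * r * h by rewrite mulVKg.
exists g, (r * (h * r' * h^-1)); split=> //.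
  apply: (subgroupM (subgroup_fixator sG _)) => //.
  by rewrite -{1}(point_stab_ray n hx); apply: fixator_conj.
have hVx : act h^-1 x0 = x0 by rewrite -{1}hx actK.
by rewrite ez eg' !mulgA [in RHS]actM hVx.
Qed.

Lemma rel_le n m x y : (n <= m)%N -> rel n x y -> rel m x y.
Proof.
by move=> le [g [r [nr ? ?]]]; exists g, r; split=> //;
  apply: fixator_ray_le le _ nr.
Qed.

Lemma rel_act n k x y : rel n x y -> rel n (act k x) (act k y).
Proof.
by move=> [g [r [nr -> ->]]]; exists (k * g), r; rewrite -!actM mulgA.
Qed.

Lemma germ_rel_refl x : Y x -> germ_rel x x.
Proof. by exists 0%N; apply: rel_refl. Qed.

Lemma germ_rel_sym x y : germ_rel x y -> germ_rel y x.
Proof. by move=> [n /rel_sym]; exists n. Qed.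

Lemma germ_rel_trans x y z : germ_rel x y -> germ_rel y z -> germ_rel x z.
Proof.
move=> [n xy] [m yz]; exists (maxn n m).
by apply: rel_trans (rel_le (leq_maxl _ _) xy) (rel_le (leq_maxr _ _) yz).
Qed.

Lemma germ_rel_act k x y : germ_rel x y -> germ_rel (act k x) (act k y).
Proof. by move=> [n /(rel_act k)]; exists n. Qed.

Lemma germ_rel_orb x y : germ_rel x y -> Y x /\ Y y.
Proof. by move=> [n [g [r [_ -> ->]]]]; split; [exists g | exists (g * r)]. Qed.

Definition mixed A n : set X := [set x | exists2 y,
  rel n x y & ~ (A x <-> A y)].

(** The [rel n] class of [x] is its orbit under the fixator of a vertex of level [n], which is
    finite. If [A] splits it, it contains a boundary point of [A] for generators of that fixator.
    Only boundary points with finite orbits are retained, so the union is finite. *)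
Lemma finite_mixed A n : commensurated setT act A -> finite_set (mixed A n).
Proof.
move=> cA.
have /choice[S SP] : forall v, exists S, finite_set S /\
  generated S = fixator v.
  by move=> v; have [S finS genS] := finitely_generated_fixator fgG rigid_index
    v; exists S.
pose good v m := finite_set (orb act (fixator v) m).
apply: (@sub_finite_set _ _ (\bigcup_(v in [set v | level v = n])
  \bigcup_(m in bd act (S v) A `&` good v) orb act (fixator v) m)).
  move=> x [y [g [r [nr ex ey]]] nxy].
  pose v := tact g (xi n).
  have sF : is_subgroup (fixator v) by exact: subgroup_fixator.
  have finx : good v x.
    apply: (finite_orb_conj act1 actM (m := g^-1) (P' := fixator (xi n))).
      by move=> p /(@fixator_conj _ _ _ g^-1 _ _); rewrite tactK.
    by rewrite ex actK.
  exists v; first by rewrite /= level_tact ray_level.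
  have [[m [xm bm]]|nm] := pselect (exists m, orb act (fixator v) x m /\
    bd act (S v) A m).
    exists m; first by split=> //; rewrite /good (orb_eq act1 actM sF xm).
    by rewrite (orb_eq act1 actM sF xm); apply: orb_refl.
  case: nxy.
  have -> : y = act (g * r * g^-1) x by rewrite ex ey !actM actK.
  have [finS genS] := SP v.
  rewrite (generated_const act1 actM (S := S v) (O :=
    orb act (fixator v) x)) //.
  - by rewrite genS; apply: preserved_orb.
  - by move=> m xm bm; apply: nm; exists m.
  - by rewrite genS; apply: fixator_conj.
  - exact: orb_refl.
apply: bigcup_finite; first exact: finite_level.
move=> v _; apply: bigcup_finite; last by move=> m [].
apply: finite_setIl; have [finS _] := SP v.
by apply: (finite_bd act1 actM (M := setT)) => //; apply: subgroupT.
Qed.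

Lemma mixed_le A n m : (n <= m)%N -> mixed A n `<=` mixed A m.
Proof. by move=> le x [y xy nA]; exists y => //; apply: rel_le xy. Qed.

(* The classes containing points of [mixed A n] change with [n] only through
   classes meeting the boundary of [A], because words in the generators carry a
   mixed pair to a mixed pair as long as its class misses that boundary. *)
Lemma finite_mixed_classes A : commensurated setT act A ->
  exists2 D, finite_set D & D `<=` Y /\
    forall x, Y x -> (exists2 d, D d & germ_rel x d) \/
      (forall y, germ_rel x y -> A x <-> A y).
Proof.
move=> cA; have [S finS genS] := fgG.
pose M0 := bd act S A.
have finM0 : finite_set M0.
  by apply: (finite_bd act1 actM (M := setT)) => //; apply: subgroupT.
(* If the class of [x] meets the boundary of [A], then the classes of [x] and of [act s x] both
   contain a point of [B1]. *)
pose B1 := M0 `|` \bigcup_(s in S) act s @` M0.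
have finB1 : finite_set B1.
  apply: finite_setUI => //; apply: bigcup_finite => // s _;
    exact: finite_image.
pose E n := [set x | exists2 y, germ_rel x y & mixed A n y].
have EJ n x y : germ_rel x y -> E n x -> E n y.
  move=> xy [z xz Dz]; exists z => //; exact: germ_rel_trans (germ_rel_sym xy)
    xz.
have E_le n m x : (n <= m)%N -> E n x -> E m x.
  by move=> le [z xz Dz]; exists z => //; apply: mixed_le le _ Dz.
(* [E n] grows with [n], hence stabilizes on the finite set [B1]. *)
have [N stabN] : exists N, forall x, B1 x -> forall m, E m x -> E N x.
  apply: finite_set_bounded => // [x m n le Em k /Em|x _]; first exact: E_le.
  have [[n Enx]|nE] := pselect (exists n, E n x); first by exists n.
  by exists 0%N => m Em; case: nE; exists m.
pose far x := forall y, germ_rel x y -> ~ M0 y.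
have farA s x y : S s -> far x -> germ_rel x y -> A (act s y) <-> A y.
  by move=> Ss fx /fx; apply: contra_notP => mA; exists s.
have farE n s x : S s -> far x -> E n (act s x) <-> E n x.
  move=> Ss fx; split=> [[u su [u' uu' nu]]|[y xy [y' yy' ny]]].
    have xu : germ_rel x (act s^-1 u).
      by have := germ_rel_act s^-1 su; rewrite actK.
    have r' : rel n (act s^-1 u) (act s^-1 u') by apply: rel_act.
    exists (act s^-1 u) => //; exists (act s^-1 u') => // e; apply: nu.
    have xu' : germ_rel x (act s^-1 u') by apply: germ_rel_trans xu _; exists n.
    have := farA s x _ Ss fx xu; have := farA s x _ Ss fx xu'.
    by rewrite !actVK //; tauto.
  exists (act s y); first exact: germ_rel_act.
  exists (act s y'); first exact: rel_act.
  have xy' : germ_rel x y' by apply: germ_rel_trans xy _; exists n.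
  have := farA s x _ Ss fx xy; have := farA s x _ Ss fx xy'; tauto.
(* [E m] minus [E N] has no boundary in [Y]: at far points by [farE], at the others because both
   ends of the edge are represented in [B1]. So it is empty or all of [Y]. *)
have sub_case m : (forall x, Y x -> E m x -> E N x) \/ (forall x, Y x -> E m x).
  pose F := [set x | E m x /\ ~ E N x].
  have nF x : Y x -> ~ bd act S F x.
    move=> Yx [s Ss]; apply.
    have [fx|nfx] := pselect (far x).
      have := farE m s x Ss fx; have := farE N s x Ss fx; rewrite /F /=; tauto.
    have [y xy My] : exists2 y, germ_rel x y & M0 y.
      by apply: contrapT => ny; apply: nfx => y xy My; apply: ny; exists y.
    have nFy z b : germ_rel z b -> B1 b -> ~ F z.
      move=> zb Bb [Em]; apply; apply: (EJ _ _ _ (germ_rel_sym zb)).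
      by apply: (stabN b Bb m); apply: (EJ _ _ _ zb).
    have n1 : ~ F x by apply: nFy xy _; left.
    have n2 : ~ F (act s x).
      by apply: nFy (germ_rel_act s xy) _; right; exists s => //; exists y.
    by split.
  have constF x y : Y x -> Y y -> F x -> F y.
    move=> Yx [k _ <-] Fx.
    have [j _ ex] := Yx.
    have -> : act k x0 = act (k * j^-1) x by rewrite -ex actM actK.
    apply/(generated_const act1 actM (S := S) (O := Y)) => //; rewrite genS //.
    by apply: preserved_orb => //; apply: subgroupT.
  have [[x Yx Fx]|nx] := pselect (exists2 x, Y x & F x).
    by right=> y Yy; have [] := constF x y Yx Yy Fx.
  left=> x Yx Em; apply: contrapT => nE; apply: nx; exists x => //.
have DY n : mixed A n `<=` Y by move=> x [y [g [r [_ -> _]]] _]; exists g.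
have [[m mY]|nm] := pselect (exists m, forall x, Y x -> E m x).
  exists (mixed A m); first exact: finite_mixed.
  by split=> // x /mY[d xd Dd]; left; exists d.
exists (mixed A N); first exact: finite_mixed.
split=> // x Yx; have [[d xd Dd]|nE] := pselect (E N x); first by left;
  exists d.
right=> y [n xy]; apply: contrapT => nA; apply: nE.
have [|Ym] := sub_case n; last by case: nm; exists n.
apply=> //; exists x; first exact: germ_rel_refl.
by exists y.
Qed.

Let J := [set g : Gt | exists n, fixator (xi n) g].

Lemma germ_class g : [set y | germ_rel (act g x0) y] = act g @` orb act J x0.
Proof.
apply/seteqP; split=> y.
  move=> [n [k [r [nr e ->]]]]; pose h := g^-1 * k.
  have hx : act h x0 = x0 by rewrite actM -e actK.
  have hVx : act h^-1 x0 = x0 by rewrite -{1}hx actK.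
  exists (act (h * r * h^-1) x0).
    exists (h * r * h^-1) => //; exists n.
    by rewrite -{1}(point_stab_ray n hx); apply: fixator_conj.
  by rewrite (actM (h * r)) hVx -actM mulgA /h mulVKg.
by move=> [_ [r [n nr] <-] <-]; exists n, g, r.
Qed.

Lemma infinite_germ_class x : infinite_set (orb act J x0) -> Y x ->
  infinite_set [set y | germ_rel x y].
Proof.
move=> infJ [g _ <-]; rewrite germ_class; apply: contra_not infJ => fin.
apply: sub_finite_set (finite_image (act g^-1) fin) => y Jy.
by exists (act g y); [exists y | rewrite actK].
Qed.

(** Finitely many classes would leave finitely many rays in the orbit of [xi]. Below some [xi N]
    only [xi] would remain, so [J] would fix that whole subtree and have a finite orbit at [x0]. *)
Lemma exists_class_off (D : set X) : infinite_set (orb act J x0) ->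
  finite_set D -> D `<=` Y -> exists2 x, Y x & forall d, D d -> ~ germ_rel x d.
Proof.
move=> infJ finD DY; apply: contrapT => nx.
have cov x : Y x -> exists2 d, D d & germ_rel x d.
  move=> Yx; apply: contrapT => nd; apply: nx; exists x => // d Dd xd.
  by apply: nd; exists d.
(* By [orb_point_ray] the translate of [xi] by [g] depends only on [d]: either it is [xi], or it has
   left [xi] by level [n]. *)
pose Q d n := forall g, act g x0 = d ->
  (forall k, tact g (xi k) = xi k) \/ (forall k, (n <= k)%N ->
    tact g (xi k) <> xi k).
have [N NQ] : exists N, forall d, D d -> Q d N.
  apply: finite_set_bounded => // [d m n le Qm g /Qm[fix_g|mov]|d /DY[g _ gd]].
  - by left.
  - by right=> k nk; apply: mov; apply: leq_trans nk.
  have [fix_g|/existsNP[k0 mov]] := pselect (forall k, tact g (xi k) = xi k).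
    by exists 0%N => h hd; left=> k; rewrite (@orb_point_ray h g) ?hd ?gd.
  exists k0 => h hd; right=> k le e; apply: mov.
  by rewrite (@orb_point_ray g h) ?hd ?gd //; apply: ray_fix_le le e.
apply: infJ; apply: sub_finite_set (finxi N) => _ [r [m mr] <-]; exists r => //.
have [leNm|/ltnW lemN] := leqP N m; last exact: fixator_ray_le lemN _ mr.
move=> w Nw; have leNw : (N <= level w)%N.
  by case: Nw => k /(congr1 (@level T)); rewrite level_iter_parent ray_level;
    lia.
have [g gw] := transT (etrans (ray_level xi (level w)) erefl).
have [d Dd [n [g' [r' [nr' e1 e2]]]]] :=
  cov (act g x0) (ex_intro2 _ _ g I erefl).
have gg' k : tact g (xi k) = tact (g' * r') (xi k).
  by rewrite (orb_point_ray _ e1) tactM (fixator_ray _ nr').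
have [fix_g|mov] := NQ d Dd (g' * r') (esym e2).
  by rewrite -gw gg' fix_g (fixator_ray _ mr).
case: (mov N (leqnn N)); rewrite -gg'.
have par k v : tact g (iter k (@parent T) v) = iter k (@parent T) (tact g v).
  by elim: k => //= k <-; apply: aut_parent.
rewrite -[in LHS](ray_ancestor xi N (level w - N)) subnK // par gw.
by rewrite [RHS](subtree_ancestor Nw) ray_level.
Qed.

(** As in [finite_of_constant_orbit], translating the class of [z] shows that every class has
    finitely many points of [A]. Classes being infinite, one not represented in [D] has none. *)
Lemma finite_of_constant_class (D A : set X) z :
  infinite_set (orb act J x0) -> finite_set D -> D `<=` Y ->
  (forall g, finite_set (moved act A g)) ->
  (forall x, Y x -> (exists2 d, D d & germ_rel x d) \/
      (forall y, germ_rel x y -> A x <-> A y)) ->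
  Y z -> (forall y, germ_rel z y -> ~ A y) -> finite_set (A `&` Y).
Proof.
move=> infJ finD DY cA classA Yz zA.
have fin_class x : Y x -> finite_set [set y | germ_rel x y /\ A y].
  move=> [g _ <-]; have [h _ hz] := Yz.
  have ez : act (g * h^-1) z = act g x0 by rewrite -hz actM actK.
  apply: sub_finite_set (cA (g * h^-1)^-1) => y [xy Ay] e.
  apply: (zA (act (g * h^-1)^-1 y)); last exact/e.
  by rewrite -(actK act1 actM (g * h^-1) z) ez; apply: germ_rel_act.
apply: (@sub_finite_set _ _ (\bigcup_(d in D) [set y | germ_rel d y /\ A y])).
  move=> x [Ax Yx]; have [[d Dd xd]|cx] := classA x Yx.
    by exists d => //; split=> //; apply: germ_rel_sym.
  case: (infinite_germ_class infJ Yx).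
  by apply: sub_finite_set (fin_class x Yx) => y xy; split=> //;
    apply/(cx y xy).
by apply: bigcup_finite => // d /DY; apply: fin_class.
Qed.

Lemma infinite_class_trivial A : commensurated setT act A -> A `<=` Y ->
  infinite_set (orb act J x0) -> finite_set A \/ finite_set (Y `\` A).
Proof.
move=> cA AY infJ; have [D finD [DY classA]] := finite_mixed_classes cA.
have mA g : finite_set (moved act A g).
  by apply: (commensuratedP act1 actM A (subgroupT _)).1.
have [z Yz nz] := exists_class_off infJ finD DY.
have constz y : germ_rel z y -> A z <-> A y.
  by have [[d Dd /nz]|] := classA z Yz; [case/(_ Dd) | apply].
have [Az|nAz] := pselect (A z).
  right; have -> : Y `\` A = ~` A `&` Y by rewrite setIC setDE.
  apply: (finite_of_constant_class infJ finD DY _ _ Yz).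
  - by move=> g; rewrite moved_setC.
  - move=> x /classA[?|cx]; [by left | right=> y /cx]; rewrite /setC /=; tauto.
  - by move=> y /constz Ay; apply; apply/Ay.
left; have <- : A `&` Y = A by apply: setIidl.
by apply: (finite_of_constant_class infJ finD DY mA classA Yz) => y /constz <-.
Qed.

Hypothesis germ_index : finite_index (germ_stab G xi) (stab G xi).

Lemma subgroup_germ_stab_set : is_subgroup (germ_stab G xi).
Proof.
have sJ := subgroup_germ_stab xi.
have mem (a : tree_aut T) : germ_stab G xi a -> exists2 h : Gt, val h = a & J h.
  move=> Ja; have Ga : G a by case: Ja.
  by exists (of_mem sG Ga) => //; apply/germ_stabE.
apply/is_subgroupP; split.
- by have /germ_stabE := subgroup1 sJ.
- move=> _ _ /mem[a <- Ja] /mem[b <- Jb].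
  by have /germ_stabE := subgroupM sJ Ja Jb.
- by move=> _ /mem[a <- Ja]; have /germ_stabE := subgroupV sJ Ja.
Qed.

Lemma translate_inj (g : tree_aut T) : injective (@translate (tree_aut T) g).
Proof.
by move=> U V e; rewrite -(translate1 U) -(translate1 V) -(mulVg g) !translateM
  e.
Qed.

Lemma finite_class_germs A : commensurated setT act A -> A `<=` Y ->
  finite_set (orb act J x0) ->
  exists (A' : set (set (tree_aut T))) (k m C : nat),
    [/\ A' `<=` germ_vertices G xi,
        commensurated G (@translate (tree_aut T)) A',
        (0 < k)%N, (0 < m)%N
      & forall g : Gt, exists n, [/\ (k * n = m * nu (@translate (tree_aut T))
        A' (val g))%N,
          (nu act A g <= n + C)%N & (n <= nu act A g + C)%N]].
Proof.
move=> cA AY finJ; have [D finD [DY classA]] := finite_mixed_classes cA.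
have sT := subgroupT Gt.
(* The largest union of classes inside [A]. Only points of the finitely many split classes are lost,
   and these classes are finite. *)
pose A1 := [set x | Y x /\ forall y, germ_rel x y -> A y].
have A1A : A1 `<=` A by move=> x [Yx]; apply; apply: germ_rel_refl.
have finAA1 : finite_set (A `+` A1).
  apply: (@sub_finite_set _ _ (\bigcup_(d in D) [set y | germ_rel d y])).
    move=> x [[Ax nA1x]|[/A1A]//].
    have [[d Dd xd]|cx] := classA x (AY _ Ax).
      by exists d => //; apply: germ_rel_sym.
    by case: nA1x; split=> [|y /cx <- //]; apply: AY.
  apply: bigcup_finite => // d /DY[g _ <-]; rewrite germ_class.
  exact: finite_image.
have cA1 : commensurated setT act A1 by apply: (commensurated_near act1 actM sT
  finAA1).
have finA1A : finite_set (A1 `+` A) by rewrite setYC.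
have satA1 x y : germ_rel x y -> A1 x -> A1 y.
  move=> xy [Yx xA]; split; first by case: (germ_rel_orb xy).
  by move=> z yz; apply: xA; apply: germ_rel_trans yz.
pose J0 := germ_stab G xi.
have sJ0 : is_subgroup J0 := subgroup_germ_stab_set.
(* [Y] and the cosets of [J0] are both orbits of [Gt]; [R] relates the two images of each group
   element. *)
pose R x c := exists g : Gt, x = act g x0 /\ c = translate (val g) J0.
have coset_rel g h : translate (val g) J0 = translate (val h) J0 ->
    germ_rel (act g x0) (act h x0).
  move=> /(translate_eq _ _ sJ0); rewrite -val_inv -val_mul =>
    /germ_stabE[n ngh].
  by exists n, g, (g^-1 * h); rewrite mulVKg.
pose A2 := [set c | exists g : Gt, c = translate (val g) J0 /\ A1 (act g x0)].
have R_A x c : R x c -> A1 x <-> A2 c.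
  move=> [g [-> ->]]; split=> [A1g|[h [e A1h]]]; first by exists g.
  by apply: satA1 (A1h); apply: coset_rel.
have R_act h x c : R x c -> R (act h x) (translate (val h) c).
  by move=> [g [-> ->]]; exists (h * g); rewrite actM translateM.
pose dE := displacementE (@translate1 (tree_aut T)) (@translateM (tree_aut T)).
have R_disp g x c : R x c ->
    displacement act A1 g x <-> displacement (@translate (tree_aut T)) A2 (val
      g) c.
  move=> Rxc; rewrite (displacementE act1 actM) dE /moved /=.
  by rewrite (R_A x c Rxc) (R_A _ _ (R_act g^-1 _ _ Rxc)).
(* The stabilizer of [x0] fixes [xi], so this is at most the index of the germ stabilizer in the
   stabilizer of [xi]. *)
pose k := ncard [set c | R x0 c].
have fink : finite_set [set c | R x0 c].
  apply: sub_finite_set germ_index => c [g [e ->]]; exists (val g) => //.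
  split; first exact: subgroup_typeP.
  by apply: ray_ext => n; apply: point_stab_ray.
(* The fibre over [J0] is the orbit of [x0] under [J]. *)
pose m := ncard [set x | R x J0].
have finm : finite_set [set x | R x J0].
  apply: sub_finite_set finJ => x [g [-> e]]; exists g => //.
  apply/germ_stabE; have := translate_eq 1 (val g) sJ0.
  by rewrite translate1 invg1 mul1g => -[/(_ e)].
have fib_k x : Y x -> finite_set [set c | R x c] /\ ncard [set c | R x c] = k.
  move=> [g _ <-].
  have -> : [set c | R (act g x0) c] = translate (val g) @` [set c | R x0 c].
    apply/seteqP; split=> c; last by move=> [d Rd <-]; apply: R_act.
    move=> Rc; exists (translate (val g^-1) c).
      by have := R_act g^-1 _ _ Rc; rewrite actK.
    by rewrite -translateM mulgV translate1.
  split; first exact: finite_image.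
  by rewrite ncard_image_inj // => ? ? _ _; apply: translate_inj.
have fib_m g : finite_set [set x | R x (translate (val g) J0)] /\
    ncard [set x | R x (translate (val g) J0)] = m.
  have -> : [set x | R x (translate (val g) J0)] = act g @` [set x | R x J0].
    apply/seteqP; split=> x; last by move=> [y Ry <-]; apply: R_act.
    move=> Rx; exists (act g^-1 x); last by rewrite actVK.
    by have := R_act g^-1 _ _ Rx; rewrite -translateM mulVg translate1.
  split; first exact: finite_image.
  by rewrite ncard_image_inj // => ? ? _ _; apply: (can_inj (actK act1 actM g)).
have R00 : R x0 J0 by exists 1; rewrite act1 translate1.
have gt0 (Z : Type) (F : set Z) z : finite_set F -> F z -> (0 < ncard F)%N.
  move=> finF Fz; rewrite lt0n; apply/eqP => F0.
  by have := ncardP finF; rewrite F0 II0 card_eq0 => /eqP F0';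
    rewrite F0' in Fz.
have disp_Y g : displacement act A1 g `<=` Y.
  move=> x [[[y [Yy _] <-] _]|[[]//]].
  by case: Yy => h _ <-; exists (g * h) => //; rewrite actM.
have count g : finite_set (displacement (@translate (tree_aut T)) A2 (val g)) /\
    (k * nu act A1 g = m * nu (@translate (tree_aut T)) A2 (val g))%N.
  have finE := cA1 g I.
  (* [R] matches the displacements of [A1] and [A2]; these pairs are counted once by points and once
     by cosets. *)
  pose RR := [set z : X * set (tree_aut T) | R z.1 z.2 /\
    displacement act A1 g z.1].
  have [finRR cardRR] : finite_set RR /\ ncard RR = (k * nu act A1 g)%N.
    apply: ncard_fibres => // [z []//|x Ex].
    have -> : [set c | RR (x, c)] = [set c | R x c].
      by apply/seteqP; split=> c; [case | split].
    by apply: fib_k; apply: disp_Y Ex.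
  have E2R c : displacement (@translate (tree_aut T)) A2 (val g) c ->
      exists h : Gt, c = translate (val h) J0.
    move=> [[[d [h [-> _]] <-] _]|[[h [-> _]] _]]; last by exists h.
    by exists (g * h); rewrite translateM.
  have finE2 : finite_set (displacement (@translate (tree_aut T)) A2 (val g)).
    apply: sub_finite_set (finite_image snd finRR) => c E2c.
    have [h eh] := E2R c E2c; have Rc : R (act h x0) c by exists h.
    exists (act h x0, c) => //; split=> //=; exact/(R_disp g _ _ Rc).
  split=> //; rewrite -cardRR.
  pose swap (z : X * set (tree_aut T)) := (z.2, z.1).
  have <- : ncard (swap @` RR) = ncard RR.
    by apply: ncard_image_inj => // -[x c] [y d] _ _ [-> ->].
  have [||_ ->] // := @ncard_fibres _ _ (swap @` RR) _ m finE2.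
    by move=> _ [[x c] [/= Rxc Ex] <-] /=; apply/(R_disp g _ _ Rxc).
  move=> c E2c; have [h eh] := E2R c E2c.
  have -> : [set x | (swap @` RR) (c, x)] = [set x | R x (translate (val h)
    J0)].
    rewrite -eh; apply/seteqP; split=> x.
      by move=> [[y d] [/= Ryd _] [<- <-]].
    by move=> Rxc; exists (x, c) => //; split=> //=; apply/(R_disp g _ _ Rxc).
  exact: fib_m.
exists A2, k, m, (ncard (A `+` A1)).*2; split.
- by move=> _ [g [-> _]]; exists (val g) => //; apply: subgroup_typeP.
- by move=> g Gg; have [] := count (of_mem sG Gg).
- exact: gt0 fink R00.
- exact: gt0 finm R00.
- move=> g; exists (nu act A1 g); split; first by case: (count g).
    by rewrite [X in (ncard X).*2]setYC; apply: (nu_near act1 actM) => //;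
      apply: cA1.
  by apply: (nu_near act1 actM) => //; apply: cA.
Qed.

End Ray.
End SmallFixators.
End GermRay.

(** * Representable functions *)

Section Representable.
Local Open Scope classical_set_scope.
Local Open Scope group_scope.
Variables (T : rooted_tree) (G : set (tree_aut T)) (sG : is_subgroup G).
Notation Gt := (subgroup_type sG).
Notation gact := (@translate (tree_aut T)).
Notation tact := (@tact T G sG).
Notation fixator := (@fixator T G sG).
Notation rigid_level := (@rigid_level T G sG).
Implicit Types (f : Gt -> nat) (g h : Gt).

(** Sums are kept as lists of terms, so that adding them is concatenation; families indexed by
    ordinals appear only in the theorem. *)
Definition germ_term : Type := rat * ray T * set (set (tree_aut T)).
Definition hom_term : Type := virtual_hom G * set (tree_aut T).

Definition valid_germ (a : germ_term) :=
  [/\ (0 < a.1.1)%R, a.2 `<=` germ_vertices G a.1.2 & commensurated G gact a.2].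

Definition valid_hom (b : hom_term) := coset_representatives G (vh_dom b.1) b.2.

Definition germ_sum (s : seq germ_term) (g : tree_aut T) : rat :=
  (\sum_(a <- s) a.1.1 * (nu gact a.2 g)%:R)%R.

Definition hom_sum (t : seq hom_term) (g : tree_aut T) : rat :=
  (\sum_(b <- t) `|vh_extend b.1 b.2 g|%:~R)%R.

Definition representable f := exists s t (C : rat),
  [/\ forall a, List.In a s -> valid_germ a,
      forall b, List.In b t -> valid_hom b
    & forall g, (`|(f g)%:R - (germ_sum s (val g) + hom_sum t (val g))| <=
      C)%R].

Lemma representable_bounded f C : (forall g, (f g <= C)%N) -> representable f.
Proof.
move=> bf; exists [::], [::], C%:R%R; split=> // g.
by rewrite /germ_sum /hom_sum !big_nil (addr0 (0 :
  rat)%R) subr0 ger0_norm ?ler0n // ler_nat.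
Qed.

Lemma representableD f f' :
  representable f -> representable f' -> representable (fun g => f g + f' g)%N.
Proof.
move=> [s [t [C [vs vt bnd]]]] [s' [t' [C' [vs' vt' bnd']]]].
exists (s ++ s'), (t ++ t'), (C + C')%R; split.
- by move=> a /(List.in_app_or s s')[/vs|/vs'].
- by move=> b /(List.in_app_or t t')[/vt|/vt'].
move=> g; rewrite /germ_sum /hom_sum !big_cat /= -!/(germ_sum _ _) -!/(hom_sum _
  _).
apply: le_trans (lerD (bnd g) (bnd' g)); apply: le_trans (ler_normD _ _).
rewrite natrD; set a := (f g)%:R%R; set a' := (f' g)%:R%R.
rewrite (_ : (a + a' - _)%R = (a - (germ_sum s (val g) + hom_sum t (val g)) +
  (a' - (germ_sum s' (val g) + hom_sum t' (val g))))%R) //; lra.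
Qed.

Lemma representable_near f f' C :
  (forall g, (f g <= f' g + C)%N /\ (f' g <= f g + C)%N) ->
  representable f -> representable f'.
Proof.
move=> ff' [s [t [D [vs vt bnd]]]]; exists s, t, (D + C%:R)%R; split=> // g.
have := bnd g; have [] := ff' g; rewrite -!(ler_nat rat) !natrD !ler_norml; lra.
Qed.

Lemma representable_germ f (xi : ray T) A k m C :
  A `<=` germ_vertices G xi -> commensurated G gact A -> (0 < k)%N ->
    (0 < m)%N ->
  (forall g, exists n, [/\ (k * n = m * nu gact A (val g))%N,
     (f g <= n + C)%N & (n <= f g + C)%N]) ->
  representable f.
Proof.
move=> Axi cA k0 m0 fA.
exists [:: ((m%:R / k%:R)%R, xi, A)], [::], C%:R%R; split=> //.
  by move=> a [<-|//]; split=> //=; rewrite divr_gt0 ?ltr0n.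
move=> g; rewrite /germ_sum /hom_sum big_seq1 big_nil addr0 /=.
have [n [e le1 le2]] := fA g.
have -> : (m%:R / k%:R * (nu gact A (val g))%:R = n%:R :> rat)%R.
  have k0' : (k%:R != 0 :> rat)%R by rewrite pnatr_eq0 -lt0n.
  apply: (mulfI k0'); rewrite mulrA mulrCA divff // mulr1 -!natrM.
  by rewrite e.
by move: le1 le2; rewrite -!(ler_nat rat) !natrD ler_norml; lra.
Qed.

(** The value [1] outside [G] is a default: the function of a [virtual_hom] is defined on the whole
    ambient group. *)
Definition lift (a : tree_aut T) : Gt :=
  match pselect (G a) with left Ga => of_mem sG Ga | right _ => 1 end.

Lemma liftK g : lift (val g) = g.
Proof.
rewrite /lift; case: pselect => [Gg|]; first exact: val_inj.
by case; apply: subgroup_typeP.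
Qed.

Section VirtualHomOfSubgroup.
Variables (M : set Gt) (phi : Gt -> int).
Hypotheses (sM : is_subgroup M) (fM : finite_index M setT) (addphi :
  additive_on M phi).

Definition val_set : set (tree_aut T) := [set a | exists2 g, M g & val g = a].

Lemma subgroup_val_set : is_subgroup val_set.
Proof.
apply/is_subgroupP; split.
- by exists 1 => //; apply: subgroup1.
- by move=> _ _ [a Ma <-] [b Mb <-]; exists (a * b) => //; apply: subgroupM.
- by move=> _ [a Ma <-]; exists a^-1 => //; apply: subgroupV.
Qed.

Lemma val_set_sub : val_set `<=` G.
Proof. by move=> _ [a _ <-]; apply: subgroup_typeP. Qed.

Lemma finite_index_val_set : finite_index val_set G.
Proof.
have [r' [finr' rM' _]] := finite_index_rep sM fM.
apply: (finite_index_map subgroup_val_set finr' (tau := fun a => r' (lift a))).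
  by move=> a _; exists (lift a).
move=> a b Ga Gb.
rewrite -[a]/(val (of_mem sG Ga)) -[b]/(val (of_mem sG Gb)) !liftK => e.
exists ((of_mem sG Ga)^-1 * of_mem sG Gb) => //.
have [_ H1] := rM' (of_mem sG Ga) I; have [_] := rM' (of_mem sG Gb) I.
rewrite -e => H2; have := subgroupM sM (subgroupV sM H1) H2.
by rewrite invgM invgK !mulgA mulgK.
Qed.

Lemma lift_morph : {in val_set &, {morph (fun a => phi (lift a)) :
  x y / x * y >-> (x + y)%R}}.
Proof.
move=> a b; rewrite !inE => -[g Mg <-] [h Mh <-].
by rewrite -val_mul !liftK addphi.
Qed.

Definition lift_hom : virtual_hom G :=
  VirtualHom subgroup_val_set val_set_sub finite_index_val_set lift_morph.

End VirtualHomOfSubgroup.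

(** Write [g = h * u] with [h] in [M] and [u] among finitely many representatives. Subadditivity
    bounds the difference of [f g] and [f h] by [f u + f u^-1], and the extended homomorphisms take
    at [g] their values at [h]. *)
Lemma representable_virtual_sum f : (forall g h,
  (f (g * h)%g <= f g + f h)%N) ->
  virtual_sum f -> representable f.
Proof.
move=> subf [M [s [C [sM fM adds bnd]]]].
have [r [finr rin rM]] := finite_index_rep sM fM.
(* Inverting turns representatives of left cosets into representatives of the right cosets used by
   [vh_extend]. *)
pose R : set Gt := [set t | exists g, t = (r g)^-1].
pose Om : set (tree_aut T) := [set a | exists2 t, R t & val t = a].
have rP g : M ((r g)^-1 * g) by case: (rin g I).
have finR : finite_set R.
  by apply: sub_finite_set (finite_image (fun t => t^-1) finr) => _ [g ->];
    exists (r g) => //; exists g.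
have RM g : exists2 t, R t & M (g * t^-1).
  exists (r g^-1)^-1; first by exists g^-1.
  by have := subgroupV sM (rP g^-1); rewrite invgM !invgK.
have Runiq g t t' : R t -> R t' -> M (g * t^-1) -> M (g * t'^-1) -> t = t'.
  move=> [a ->] [b ->]; rewrite !invgK => Ma Mb.
  have Mab : M ((r a)^-1 * r b).
    by have := subgroupM sM (subgroupV sM Ma) Mb; rewrite invgM !mulgA mulgVK.
  have rr c : r (r c) = r c by apply: rM.
  by rewrite -(rr a) -(rr b) (rM _ _ Mab).
have repOm (D : set (tree_aut T)) : D = val_set M ->
  coset_representatives G D Om.
  move=> ->; split=> [_ [t _ <-]|a Ga]; first exact: subgroup_typeP.
  have [t Rt Mt] := RM (of_mem sG Ga).
  exists (val t); split.
    split; first by exists t.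
    by exists (of_mem sG Ga * t^-1).
  move=> _ [[t' Rt' <-] [u Mu eu]]; congr val.
  apply: (Runiq (of_mem sG Ga)) => //.
  suff <- : u = of_mem sG Ga * t'^-1 by [].
  by apply: val_inj; rewrite eu.
have [B BR] : exists B, forall t, R t -> (f t + f t^-1 <= B)%N.
  by apply: finite_set_bounded => // [t m n le1 /leq_trans|t _];
    [apply | exists (f t + f t^-1)%N].
have [t [tOm tE]] : exists t : seq hom_term, (forall b, List.In b t ->
  valid_hom b) /\
    forall h u, M h -> R u -> hom_sum t (val (h * u)) = (sum_abs s h)%:R%R.
  elim: s adds {bnd} => [|phi s IHs] adds.
    by exists [::]; split=> // h u _ _; rewrite /hom_sum /sum_abs !big_nil.
  have [|t [tOm tE]] := IHs; first by move=> psi spsi; apply: adds; right.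
  have addphi : additive_on M phi by apply: adds; left.
  exists ((lift_hom sM fM addphi, Om) :: t); split.
    by move=> b [<-|/tOm //]; apply: repOm.
  move=> h u Mh Ru; rewrite /hom_sum /sum_abs !big_cons -/(hom_sum _ _)
    -/(sum_abs _ _) tE //.
  have ext : vh_extend (lift_hom sM fM addphi) Om (val (h * u)) = phi h.
    rewrite val_mul (vh_extendE (phi := lift_hom sM fM addphi) sG (repOm _
      erefl)) /= ?liftK //.
      by exists h.
    by exists u.
  rewrite natrD; congr (_ + _)%R.
  transitivity (`|phi h|%:~R : rat)%R; last by rewrite -abszE pmulrn.
  by congr (`|_|%:~R)%R; exact: ext.
exists [::], t, (B + C)%:R%R; split=> // g.
have [u Ru Mu] := RM g.
have eg : g = g * u^-1 * u by rewrite mulgVK.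
rewrite {2 3}eg tE // /germ_sum big_nil add0r.
have [le1 le2] := bnd _ Mu; have leB := BR u Ru.
have sub1 := subf (g * u^-1) u; have sub2 := subf g u^-1; rewrite -eg in sub1.
have {le1} le1 : (f g <= sum_abs s (g * u^-1) + (B + C))%N by lia.
have {le2} le2 : (sum_abs s (g * u^-1) <= f g + (B + C))%N by lia.
by move: le1 le2; rewrite -!(ler_nat rat) 2!natrD ler_norml; lra.
Qed.

Section Actions.
Hypothesis lfT : locally_finite T.
Hypothesis fgG : finitely_generated [set: Gt].
Hypothesis rigid_index : forall n, finite_index (rigid_level n) [set: Gt].
Hypothesis transT : forall v w : T, level v = level w -> exists g, tact g v = w.
Hypothesis germs : finite_germs G.
Variables (X : Type) (act : Gt -> X -> X).
Hypotheses (act1 : forall x, act 1 x = x)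
  (actM : forall g h x, act (g * h) x = act g (act h x)).
Implicit Types (x y : X) (A : set X).

Lemma nu_subadditive A g h : commensurated setT act A ->
  (nu act A (g * h)%g <= nu act A g + nu act A h)%N.
Proof.
move=> cA; have dE := displacementE act1 actM A.
have fg := cA g I; have fh := cA h I; rewrite dE in fg; rewrite dE in fh.
rewrite /nu !dE.
have fI : finite_set (act g @` moved act A h^-1) by exact: finite_image.
apply: (@leq_trans (ncard (moved act A g^-1 `|` act g @` moved act A h^-1))).
  apply: leq_ncard; first exact: finite_setUI.
  move=> x; rewrite /moved /= invgM actM => nx.
  have [gx|] := pselect (A (act g^-1 x) <-> A x); last by left.
  right; exists (act g^-1 x); last by rewrite (actVK act1 actM).
  by rewrite /=; tauto.
apply: leq_trans (leq_ncardU fg fI) _; rewrite leq_add2l;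
  exact: leq_ncard_image.
Qed.

Lemma representable_transitive x0 A : commensurated setT act A ->
  A `<=` orb act setT x0 -> representable (nu act A).
Proof.
move=> cA AY; have sT := subgroupT Gt.
have pY : preserved act setT (orb act setT x0) by exact: preserved_orb.
have finrep : finite_set A -> representable (nu act A).
  by move=> finA; apply: representable_bounded => g;
    apply: (nu_finite act1 actM).
have [finY|infY] := pselect (finite_set (orb act setT x0)).
  by apply: finrep; apply: sub_finite_set finY.
have [small_fixator|] := pselect (forall n, exists v, level v = n /\
    finite_set (orb act (fixator v) x0)).
  have [xi finxi] := germ_ray_exists rigid_index actM infY small_fixator.
  have [finJ|infJ] := pselect (finite_set (orb act
      [set g : Gt | exists n, fixator (xi n) g] x0)).
    have [A' [k [m [C [A'xi cA' k0 m0 bnd]]]]] :=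
      finite_class_germs lfT fgG rigid_index
      transT act1 actM infY finxi (germs xi) cA AY finJ.
    exact: (representable_germ A'xi cA' k0 m0 bnd).
  have [|finCA] := infinite_class_trivial lfT fgG rigid_index transT act1 actM
    infY finxi cA AY infJ; first exact: finrep.
  by apply: representable_bounded => g; apply: (nu_cofinite act1 actM sT pY I AY
    finCA).
move=> /existsNP[n /forallNP nv].
apply: representable_virtual_sum; first by move=> g h; apply: nu_subadditive.
apply: (virtual_sum_infinite_fixator_orbits lfT fgG rigid_index act1 actM (n :=
  n) cA AY) => v y lv.
(* A finite orbit at [act g x0] is carried back to [x0], with [v] replaced by [tact g^-1 v]. *)
move=> [g _ <-] fin; apply: (nv (tact g^-1 v)); split;
  first by rewrite level_tact.
apply: (finite_orb_conj act1 actM (m := g) (P' := fixator v)) fin => p.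
by move=> /(@fixator_conj _ _ _ g _ _); rewrite tactVK.
Qed.

(** Off the orbits that meet the finite boundary of [A], membership in [A] is invariant, so finitely
    many transitive actions remain. *)
Lemma representable_nu A : commensurated setT act A -> representable (nu act A).
Proof.
move=> cA; have sT := subgroupT Gt; have [S finS genS] := fgG.
have finb : finite_set (bd act S A) by apply: (finite_bd act1 actM (M := setT)).
have [s sP] := finite_set_seq finb.
pose U := [set x | exists2 b, bd act S A b & orb act setT b x].
have pU : preserved act setT U.
  by move=> g x _ [b bb bx]; exists b => //; apply: preserved_orb.
have rest g : nu act (A `\` U) g = 0%N.
  rewrite /nu (displacementE act1 actM) (moved_setD act1 actM _ sT pU) //.
  rewrite (_ : _ `\` _ = set0) ?ncard_set0 //.
  apply/seteqP; split=> // x [mA nU]; apply: mA.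
  apply: (generated_const act1 actM (S := S) (O := ~` U)) => //;
    last by rewrite genS.
    by move=> h y _ nUy /(preservedE act1 actM y sT pU I).
  by move=> y nUy bdy; apply: nUy; exists y => //; apply: orb_refl.
apply: (@representable_near (nu act (A `&` U)) _ 0%N).
  by move=> g; rewrite (nu_split act1 actM sT pU cA I) rest !addn0.
have inS O : List.In O (map (orb act setT) s) ->
  exists2 b, bd act S A b & O = orb act setT b.
  by move=> /List.in_map_iff[b [<- /sP bb]]; exists b.
have cAU : commensurated setT act (A `&` U) by apply: (commensurated_setI act1
  actM).
apply: (nu_pieces act1 actM (M := setT) (s := map (orb act setT) s)) => //.
- move=> f f' ff'; apply: (@representable_near f f' 0%N) => g.
  by rewrite ff' ?inE // addn0.
- exact: (@representable_bounded _ 0%N).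
- exact: representableD.
- by move=> O /inS[b _ ->]; apply: preserved_orb.
- by move=> O O' /inS[b _ ->] /inS[b' _ ->]; apply: orb_disjoint.
- move=> x [_ [b bb bx]]; exists (orb act setT b) => //.
  by apply/List.in_map_iff; exists b; split=> //; apply/sP.
- move=> O /inS[b _ ->]; apply: (@representable_transitive b);
  last by move=> x [].
  by apply: (commensurated_setI act1 actM) => //; apply: preserved_orb.
Qed.

End Actions.
End Representable.

(** * Passage from the ambient group to the subgroup type, and the conclusion *)

Section Transfer.
Local Open Scope classical_set_scope.
Local Open Scope group_scope.

Lemma List_In_nth (A : Type) (x0 : A) (s : seq A) i :
  (i < size s)%N -> List.In (nth x0 s i) s.
Proof. by elim: s i => //= x s IHs [_|i /IHs]; [left | right]. Qed.

Lemma List_In_tnth (A : Type) (s : seq A) (i : 'I_(size s)) :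
  List.In (tnth (in_tuple s) i) s.
Proof. by rewrite (tnth_nth (tnth (in_tuple s) i)); apply: List_In_nth. Qed.

Lemma finite_index_rigid_level (T : rooted_tree) (G : set (tree_aut T))
    (sG : is_subgroup G) n :
  finite_index (rist_level G n) G -> finite_index (@rigid_level T G sG n) setT.
Proof.
move=> fG.
have UG : rist_level G n `<=` G by move=> g;
  apply: generated_ind => // h [v _ []].
have sR : is_subgroup (rist_level G n) by exact: subgroup_generated.
have := finite_index_preimage sG sR (fun g Gg => Gg) fG.
have -> : [set g : subgroup_type sG | G (val g)] = setT.
  by apply/seteqP; split=> // g _; apply: subgroup_typeP.
apply: finite_index_super => //.
- exact: subgroup_preimage.
- exact: subgroup_generated.
move=> g /(generated_preimage (sG := sG)) Ug.
apply: (generated_ind _ _ (Ug _)); first exact: subgroup_generated.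
  by move=> h [v lv [_ hv]]; apply: sub_generated; exists v.
by move=> h [v _ []].
Qed.

End Transfer.

Unset Implicit Arguments.
Local Open Scope classical_set_scope.
Local Open Scope ring_scope.

Theorem corollary4p14 (T : rooted_tree) (G : set (tree_aut T))
    (T_locally_finite : locally_finite T)
    (T_homogeneous : spherically_homogeneous T)
    (G_subgroup : is_subgroup G)
    (G_fin_gen : finitely_generated G)
    (G_branch : branch_group G)
    (G_germs : finite_germs G)
    (f : tree_aut T -> nat) (f_card : cardinal_definite G f) :
  exists (r s : nat) (alpha : 'I_r -> rat) (xi : 'I_r -> ray T)
         (A : 'I_r -> set (set (tree_aut T)))
         (phi : 'I_s -> virtual_hom G) (Omega : 'I_s -> set (tree_aut T)),
    [/\ forall i, 0 < alpha i,
        forall i, A i `<=` germ_vertices G (xi i),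
        forall i, commensurated G (@translate (tree_aut T)) (A i),
        forall i, coset_representatives G (vh_dom (phi i)) (Omega i)
      & bounded_distance G (fun g => (f g)%:R)
          (fun g =>
             (\sum_(i < r) alpha i * (nu (@translate (tree_aut T)) (A i) g)%:R)
             + (\sum_(i < s) `|vh_extend (phi i) (Omega i) g|%:~R))].
Proof.
case: G_branch => transT rist_index.
case: f_card => X [act [A [[act1 actM] cA fE]]].
pose Gt := subgroup_type G_subgroup.
pose act' (g : Gt) := act (val g).
have [||||s [t [C [vs vt bnd]]]] := @representable_nu T G G_subgroup
  T_locally_finite
  (finitely_generated_subgroup_type G_subgroup G_fin_gen)
  (fun n => finite_index_rigid_level G_subgroup (rist_index n)) _ G_germs X act'
    _ _ A.
- move=> v w /transT[g Gg gv]; by exists (of_mem G_subgroup Gg).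
- exact: act1.
- by move=> g h x; apply: actM; apply: subgroup_typeP.
- by move=> g _; apply: cA; apply: subgroup_typeP.
exists (size s), (size t), (fun i => (tnth (in_tuple s) i).1.1),
  (fun i => (tnth (in_tuple s) i).1.2), (fun i => (tnth (in_tuple s) i).2),
  (fun i => (tnth (in_tuple t) i).1), (fun i => (tnth (in_tuple t) i).2).
split; try by move=> i; case: (vs _ (List_In_tnth i)).
  by move=> i; apply: (vt _ (List_In_tnth i)).
exists C => g Gg; have := bnd (of_mem G_subgroup Gg).
by rewrite /germ_sum /hom_sum !(big_tnth _ _ s) !(big_tnth _ _ t) fE.
Qed.
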